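(* Both of the following equivalences hold. (i) The statement ''every planar oriented graph can be vertex-partitioned into two acyclic sets'' is equivalent to the statement ''every $3$-connected, cubic, planar digraph contains a perfect matching without a directed cut''. (ii) The statement ''in every $3$-edge-connected digraph $D=(V,A)$ there exists an even subgraph $E\subseteq A$ such that $D/E$ is strongly connected'' is equivalent to the statement ''every $3$-edge-connected, cubic digraph contains a perfect matching without a directed cut''.
   Context: An oriented graph is a digraph of digirth at least $3$, where the digirth is the length of a shortest directed cycle (so there are no loops and no directed $2$-cycles). A set $V'$ of vertices of a digraph is acyclic if the subdigraph induced by $V'$ contains no directed cycle. ''Planar'', ''cubic'', ''$3$-connected'', ''$3$-edge-connected'' and ''perfect matching'' refer to the underlying undirected graph of a digraph. An even subgraph of $D=(V,A)$ is a subset $E\subseteq A$ that is an edge-disjoint union of (not necessarily directed) cycles of $D$; $D/E$ is the digraph obtained by contracting the arcs of $E$. A directed cut of $D$ is the set of all arcs between $X$ and $V\setminus X$ for some $\emptyset\neq X\subsetneq V$ such that all these arcs are directed from $X$ to $V\setminus X$. A set of arcs $M$ contains a directed cut if some directed cut of $D$ is a subset of $M$; otherwise $M$ is without a directed cut. *)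

(* Defs.v *)
From mathcomp Require Import all_boot all_fingroup.

Set Implicit Arguments.
Unset Strict Implicit.
Unset Printing Implicit Defensive.

(* Finite digraphs; loops and parallel arcs are allowed, because contractions
   create them. *)
Record digraph := Digraph {
  vert : finType;
  arcs : finType;
  src : arcs -> vert;
  tgt : arcs -> vert
}.

Section Digraph.

Variable D : digraph.
Implicit Types (X S : {set vert D}) (E F M C : {set arcs D}) (v : vert D).

Definition dicycle (c : seq (arcs D)) : bool :=
  [&& c != [::], path.cycle [rel a b | tgt a == src b] c & uniq (map (@src D) c)].

(* Digirth at least 3. *)
Definition oriented : Prop := forall c, dicycle c -> 3 <= size c.

Definition acyclic X : Prop :=
  forall c, dicycle c -> ~~ all (fun a => src a \in X) c.

Definition strongly_connected : Prop :=
  forall u v, connect [rel x y | [exists a : arcs D, (src a == x) && (tgt a == y)]] u v.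

(* Adjacency in the underlying undirected graph of (V, F). *)
Definition adj F : rel (vert D) := fun x y =>
  [exists a in F, ((src a == x) && (tgt a == y)) || ((src a == y) && (tgt a == x))].

(* The vertex set of the connected component of v in (V, F). *)
Definition component F v : {set vert D} := [set w | connect (adj F) v w].

(* A loop counts twice. *)
Definition degree F v : nat :=
  #|[set a in F | src a == v]| + #|[set a in F | tgt a == v]|.

Definition cubic : Prop := forall v, degree setT v = 3.

Definition perfect_matching M : Prop := forall v, degree M v = 1.

Definition k_connected k : Prop :=
  k < #|vert D| /\
  forall S, #|S| < k ->
  forall u v, u \notin S -> v \notin S ->
  connect [rel x y | [&& x \notin S, y \notin S & adj setT x y]] u v.

Definition k_edge_connected k : Prop :=
  1 < #|vert D| /\
  forall F, #|F| < k -> forall u v, connect (adj (~: F)) u v.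

Definition cut X : {set arcs D} := [set a | (src a \in X) != (tgt a \in X)].

Definition directed_cut C : Prop :=
  exists X, [/\ X != set0, X != setT, C = cut X
              & forall a, a \in C -> src a \in X].

Definition contains_directed_cut M : Prop :=
  exists C, directed_cut C /\ C \subset M.

(* A dart is an arc with a direction of traversal: (a, true) runs from src a
   to tgt a, and (a, false) runs backwards. *)
Definition dart : finType := (arcs D * bool)%type.

Definition dsrc (d : dart) : vert D := if d.2 then src d.1 else tgt d.1.
Definition dtgt (d : dart) : vert D := if d.2 then tgt d.1 else src d.1.

(* C is the arc set of a cycle of the underlying undirected graph; a loop is a
   cycle of length 1 and two parallel or opposite arcs form a cycle of
   length 2. *)
Definition undirected_cycle C : Prop :=
  exists c : seq dart,
    [/\ c != [::], path.cycle [rel d d' | dtgt d == dsrc d'] c, uniq (map dsrc c),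
        uniq (map fst c) & C = [set a in map fst c]].

Definition even_subgraph E : Prop :=
  exists P : {set {set arcs D}},
    partition P E /\ forall C, C \in P -> undirected_cycle C.

(* The vertices of D/E are the components of (V, E), its arcs those outside
   E. *)
Definition contract_vert E : finType :=
  {X : {set vert D} | X \in [set component E v | v : vert D]}.

Definition contract_class E v : contract_vert E :=
  Sub (component E v) (imset_f (component E) (isT : v \in vert D)).

Definition contract E : digraph :=
  @Digraph (contract_vert E) {a : arcs D | a \notin E}
    (fun a => contract_class E (src (val a)))
    (fun a => contract_class E (tgt (val a))).

Definition flip (d : dart) : dart := (d.1, ~~ d.2).

Lemma flip_inj : injective flip.
Proof. by apply: (can_inj (g := flip)) => -[a b]; rewrite /flip /= negbK. Qed.

(* A rotation system: the orbit of a dart d under s is the set of all darts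
   leaving dsrc d, in their cyclic order around this vertex. *)
Definition rotation_system (s : {perm dart}) : Prop :=
  forall d d' : dart, (d' \in porbit s d) = (dsrc d == dsrc d').

(* The faces of the embedding given by s are the orbits of d |-> s (flip d). *)
Definition faces (s : {perm dart}) : {set {set dart}} :=
  porbits (perm flip_inj * s)%g.

(* Planarity of the underlying graph, in the sense of combinatorial maps (as in
   Gonthier's proof of the Four Colour Theorem): some rotation system embeds
   each component in a sphere, i.e. has genus 0.  Summed over the components
   that have an arc, Euler's formula  #V - #A + #F = 2  reads as below; every
   component has genus at least 0, so the equality for the sum forces genus 0
   for each of them.  Isolated vertices carry no dart and impose no
   condition. *)
Definition planar : Prop :=
  exists2 s : {perm dart}, rotation_system s
  & #|[set dsrc d | d : dart]| + #|faces s| =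
    #|arcs D| + 2 * #|[set component setT (dsrc d) | d : dart]|.

End Digraph.

(* Main.v *)
Require Import Defs.
From mathcomp Require Import all_boot all_order all_fingroup all_algebra zify.

(* Both equivalences rest on replacing the vertices of a graph by gadgets.

   (ii) Contracting E leaves a strongly connected digraph iff the complement of
   E contains no directed cut, and a set of arcs is an even subgraph iff all its
   degrees are even.  In the prism over D a vertex of degree k becomes two
   k-cycles joined by k subdivided rungs, whose middle vertices (the ports)
   carry the k arcs formerly at the vertex, each port being a source or a sink.
   The prism is cubic and stays 3-edge-connected, and even subgraphs and
   directed cuts pass between it and D.  Let D be cubic and let E be an even
   subgraph of the prism whose complement contains no directed cut.  Then E meets
   every port; if it avoided all arcs of D at some vertex, it would contain all
   rungs there, and so an odd number of edges leaving one of the 3-cycles.  Hence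
   E meets every vertex of D in exactly two arcs.

   (i) A plane graph is a permutation of its darts satisfying Euler's formula.
   The incidence matrices of vertices and of faces have orthogonal row spaces, of
   ranks #V - 1 and #F - 1 if the graph is connected, so Euler's formula says
   that these spaces are orthogonal complements of each other: every circulation
   of the dual is a potential difference.  Over the field with two elements this turns the
   complement of a perfect matching of the dual into a vertex bipartition; over
   the rationals it turns a monochromatic directed cycle into a directed cut.
   Refining a map by a ring of new vertices inside each face, with a centre,
   yields a triangulation.  Applied to the dual of a cubic graph, the refinement
   has a directed ring around each triangular face and a directed triangle over
   each side, so no triangle of the dual is monochromatic in an acyclic
   bipartition, and the arcs with equally coloured sides form a perfect matching.
   Applied twice to a component of a planar oriented graph, the second time with
   all but one of each class of parallel arcs exchanged for the other diagonal,
   it yields a simple triangulation, whose dual is cubic and 3-connected. *)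

Set Implicit Arguments.
Unset Strict Implicit.
Unset Printing Implicit Defensive.

Import Order.TTheory GRing.Theory Num.Theory.

(** * Cuts and even subgraphs *)

Lemma connect_invariant (T : finType) (e : rel T) (P : pred T) x y :
  (forall u v, e u v -> P u -> P v) -> connect e x y -> P x -> P y.
Proof.
move=> eP /connectP[p + ->]; elim: p x => //= z p IHp x /andP[exz zp] Px.
exact: IHp zp (eP _ _ exz Px).
Qed.

(** A closed walk is one whose list of heads is its list of tails rotated by one step; in this form
    it can be counted with and transported by [map]. *)
Lemma cycle_relE (T : Type) (V : eqType) (f g : T -> V) (c : seq T) :
  path.cycle [rel a b | g a == f b] c = (map g c == rot 1 (map f c)).
Proof.
case: c => //= a c; rewrite rot1_cons.
suff pathE b : path [rel a b | g a == f b] b (rcons c a)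
  = (map g (b :: c) == rcons (map f c) (f a)) by rewrite pathE.
elim: c b => [|y c IHc] b /=; first by rewrite eqseq_cons.
by rewrite IHc [RHS]eqseq_cons.
Qed.

Lemma cycle_counts (T : Type) (V : eqType) (f g : T -> V) (c : seq T) v :
  path.cycle [rel a b | g a == f b] c ->
  \sum_(a <- c) (f a == v) = \sum_(a <- c) (g a == v).
Proof.
rewrite cycle_relE => /eqP eq_gf.
rewrite -(big_map f predT (fun w => nat_of_bool (w == v))).
rewrite -(big_map g predT (fun w => nat_of_bool (w == v))) eq_gf.
by apply: perm_big; rewrite perm_sym perm_rot.
Qed.

Section Cuts.

Variable D : digraph.
Implicit Types (X S : {set vert D}) (E F M C : {set arcs D}) (u v w : vert D).

Lemma degree_sum F v :
  degree F v = \sum_(a in F) ((src a == v) + (tgt a == v)).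
Proof.
rewrite big_split /= -!big_mkcondr /= !sum1_card /degree.
by congr (_ + _); apply: eq_card => a; rewrite !inE.
Qed.

Lemma degree_darts F v :
  degree F v = #|[set d : dart D | (d.1 \in F) && (dsrc d == v)]|.
Proof.
rewrite degree_sum -sum1dep_card.
under [RHS]eq_bigl => d do rewrite andbC.
rewrite -(pair_big_dep predT (fun a b => (dsrc ((a, b) : dart D) == v) && (a \in F))
  (fun _ _ => 1)) /= [LHS]big_mkcond /=; apply: eq_bigr => a _.
rewrite big_mkcond big_bool /= /dsrc /=.
by case: (a \in F); rewrite ?andbF ?andbT //; do 2!case: (_ == v).
Qed.

(** Summed over [X], an arc of [F] counts once for each of its ends in [X], hence an odd number of
    times exactly when it crosses. *)
Lemma odd_degree_sum F X :
  odd (\sum_(v in X) degree F v) = odd #|F :&: cut X|.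
Proof.
under eq_bigr => v _ do rewrite degree_sum.
rewrite exchange_big /= -sum1_card.
rewrite !(big_morph odd oddD (erefl : odd 0 = false)) /=.
rewrite [RHS](eq_bigl (fun a => (a \in F) && (a \in cut X))); last first.
  by move=> a; rewrite !inE.
rewrite [RHS]big_mkcondr /=; apply: eq_bigr => a aF.
have deltaE w : \sum_(v in X) nat_of_bool (w == v) = (w \in X).
  case: (boolP (w \in X)) => wX.
    rewrite (bigD1 w) //= eqxx big1 // => v /andP[_].
    by rewrite eq_sym => /negbTE->.
  by rewrite big1 // => v vX; case: eqP => // wv; rewrite wv vX in wX.
rewrite big_split /= !deltaE oddD !oddb inE.
by case: (src a \in X); case: (tgt a \in X).
Qed.

Lemma adj_sym F : symmetric (adj F).
Proof.
by move=> x y; apply: eq_existsb => a; rewrite orbC.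
Qed.

Lemma adj_connect_sym F : connect_sym (adj F).
Proof. exact: sym_connect_sym (@adj_sym F). Qed.

Lemma adjP F x y :
  reflect (exists2 d : dart D, d.1 \in F & dsrc d = x /\ dtgt d = y) (adj F x y).
Proof.
apply: (iffP exists_inP) => [[a aF /orP[]/andP[/eqP <- /eqP <-]]|].
- by exists (a, true).
- by exists (a, false).
case=> -[a b] /= aF [<- <-]; exists a => //.
by case: b; rewrite /dsrc /dtgt /= !eqxx ?orbT.
Qed.

Lemma adj_src_tgt F a : a \in F -> adj F (src a) (tgt a).
Proof. by move=> aF; apply/adjP; exists (a, true). Qed.

Lemma connect_cross F X u v :
  connect (adj F) u v -> u \in X -> v \notin X -> exists2 a, a \in F & a \in cut X.
Proof.
move=> uv uX vX; apply/exists_inP; apply: contraLR uv => /exists_inPn noF.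
apply: contra vX => /(connect_invariant (P := fun w => w \in X)); apply=> //.
move=> x y /exists_inP[a aF xy]; have := noF _ aF.
by rewrite inE negbK => /eqP eq_a; case/orP: xy => /andP[/eqP <- /eqP <-];
  rewrite eq_a.
Qed.

Lemma component_cut F u : F :&: cut (component F u) = set0.
Proof.
apply/setP => a; rewrite !inE; apply/negP => /andP[aF].
have st := connect1 (adj_src_tgt aF).
by rewrite (same_connect_r (adj_connect_sym F) st) eqxx.
Qed.

(** If deleting [F] separates [u] from [v], all arcs crossing the boundary of the remaining
    component of [u] belong to [F]. *)
Lemma k_edge_connectedP k :
  k_edge_connected D k <->
  1 < #|vert D| /\ forall X, X != set0 -> X != setT -> k <= #|cut X|.
Proof.
split=> -[gt1 conn]; split=> //.
  move=> X /set0Pn[u uX]; rewrite -subTset => /subsetPn[v _ vX].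
  rewrite leqNgt; apply/negP => /conn /(_ u v) /connect_cross /(_ uX vX)[a].
  by rewrite inE => /negbTE->.
move=> F ltF u v; have := component_cut (~: F) u; set X := component _ _ => X0.
have uX : u \in X by rewrite inE.
apply: contraLR ltF => uv; rewrite -leqNgt; apply: leq_trans (subset_leq_card _).
  apply: (conn X); first by apply/set0Pn; exists u.
  by apply: contraNneq uv => XT; have := in_setT v; rewrite -XT inE.
apply/subsetP => a aX; have := in_set0 a; rewrite -X0 inE aX andbT inE.
by move/negbFE.
Qed.

Definition even_degrees E := forall v, ~~ odd (degree E v).

Lemma undirected_cycle_even C : undirected_cycle C -> even_degrees C.
Proof.
case=> c [_ cyc _ uniq_c ->] v; rewrite degree_sum.
rewrite (eq_bigl [in map fst c]) => [|a]; last by rewrite inE.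
rewrite -big_uniq // big_map.
rewrite (eq_bigr (fun d => (dsrc d == v) + (dtgt d == v))) => [|[a []] _] //.
  by rewrite big_split /= (cycle_counts _ cyc) addnn odd_double.
by rewrite addnC.
Qed.

(** As the vertices are distinct, so are the arcs: a later dart on the arc of [d] would have [x] as
    an end. *)
Lemma dart_path F x p :
  path (adj F) x p -> uniq (x :: p) ->
  exists q : seq (dart D), [/\ map (@dsrc D) q = belast x p, map (@dtgt D) q = p,
    {subset map fst q <= F} & uniq (map fst q)].
Proof.
elim: p x => [|y p IHp] x; first by exists [::].
rewrite cons_uniq => /= /andP[/adjP[d dF [dx dy]] yp] /andP[x_yp uniq_yp].
have [q [srcq tgtq qF uniq_q]] := IHp y yp uniq_yp.
exists (d :: q); split; rewrite /= ?dx ?dy ?srcq ?tgtq //.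
  by move=> a; rewrite inE => /orP[/eqP->|/qF].
rewrite uniq_q andbT; apply/mapP => -[d' d'q eq_d].
have: (dsrc d' == x) || (dtgt d' == x).
  rewrite -dx; case: d d' {d'q dF dx dy} eq_d => [a []] [a' []] /= ->;
  by rewrite /dsrc /dtgt /= eqxx ?orbT.
case/orP => /eqP eq_x; case/negP: x_yp.
  by have := map_f (@dsrc D) d'q; rewrite srcq eq_x => /mem_belast.
by have := map_f (@dtgt D) d'q; rewrite tgtq eq_x inE => ->; rewrite orbT.
Qed.

Lemma even_degrees_cycle E a :
  even_degrees E -> a \in E -> exists C, [/\ a \in C, C \subset E & undirected_cycle C].
Proof.
move=> evE aE; have: connect (adj (E :\ a)) (tgt a) (src a).
  have := component_cut (E :\ a) (tgt a); set X := component _ _ => X0.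
  suff: src a \in X by rewrite inE.
  apply/negPn/negP => sX; have: ~~ odd (\sum_(v in X) degree E v).
    rewrite (big_morph odd oddD (erefl : odd 0 = false)) big1 // => v _.
    exact/negbTE/evE.
  (* Otherwise [a] is the only arc of [E] crossing the component [X] of its head, against the parity
     of the degree sum over [X]. *)
  rewrite odd_degree_sum; suff ->: E :&: cut X = [set a] by rewrite cards1.
  apply/setP => b; have := in_set0 b; rewrite -X0 !inE.
  case: eqP => [-> _|_] /=; last by case: (b \in E).
  by rewrite aE connect0; move: sX; rewrite inE => /negbTE->.
case/connectP => p0 p0P src_a.
case/shortenP: p0P src_a => p pP uniq_p _ last_p.
have [q [srcq tgtq qF uniq_q]] := dart_path pP uniq_p.
pose c : seq (dart D) := (a, true) :: q; exists [set b in map fst c]; split.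
- by rewrite !inE eqxx.
- apply/subsetP => b; rewrite !inE => /orP[/eqP-> //|/qF].
  by rewrite !inE => /andP[].
exists c; split=> //.
- rewrite cycle_relE /= rot1_cons srcq tgtq /dsrc /dtgt /=.
  by rewrite last_p -lastI.
- by rewrite [map _ _]/= srcq /dsrc /= last_p -rcons_uniq -lastI.
rewrite /= uniq_q andbT; apply/negP => /qF.
by rewrite !inE eqxx.
Qed.

(** Each cycle contributes an even amount to every degree. Conversely, remove one cycle from [E] and
    argue by induction on the number of arcs. *)
Lemma even_subgraphP E : even_subgraph E <-> even_degrees E.
Proof.
split=> [[P [partP cycP]] v|].
  rewrite degree_sum (set_partition_big _ partP) /=.
  rewrite (big_morph odd oddD (erefl : odd 0 = false)) big1 // => C CP.
  by rewrite -degree_sum; apply/negbTE/undirected_cycle_even/cycP.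
elim/(@ltn_ind): {E}#|E| {-2}E (leqnn #|E|) => n IHn E leEn evE.
have [->|/set0Pn[a aE]] := eqVneq E set0.
  exists set0; split; last by move=> C; rewrite inE.
  by rewrite partition_set0.
have [C [aC CE cycC]] := even_degrees_cycle evE aE.
have [||P [partP cycP]] := IHn #|E :\: C| _ (E :\: C) (leqnn _).
- apply: leq_trans leEn; apply: proper_card; rewrite properE subsetDl.
  by apply/subsetPn; exists a; rewrite // inE aC.
- move=> v; have := evE v; have := undirected_cycle_even cycC v.
  rewrite !degree_sum [X in _ -> ~~ odd X -> _](big_setID C) /=.
  by rewrite (setIidPr CE) oddD => /negbTE->.
exists (C |: P); split; last by move=> C' /setU1P[-> //|/cycP].
have C0 : C != set0 by apply/set0Pn; exists a.
have dis : [disjoint C & E :\: C].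
  by rewrite -setI_eq0; apply/eqP/setP => b; rewrite !inE; case: (b \in C).
have -> : E = C :|: (E :\: C) by rewrite setDE setUIr setUCr setIT; apply/esym/setUidPr.
have /and3P[/eqP covP trivP P0] := partP.
apply/and3P; split.
- by rewrite /cover bigcup_setU big_set1 -/(cover P) covP.
- apply/trivIsetP => B1 B2 /setU1P[->|B1P] /setU1P[->|B2P] neqB.
  + by rewrite eqxx in neqB.
  + apply: disjointWr dis; rewrite -covP; exact: bigcup_sup.
  + rewrite disjoint_sym; apply: disjointWr dis; rewrite -covP; exact: bigcup_sup.
  + exact: (trivIsetP trivP).
by rewrite !inE negb_or eq_sym C0 P0.
Qed.

End Cuts.

(** * Contraction and directed cuts *)

Section Contraction.

Variable D : digraph.
Implicit Types (X : {set vert D}) (E : {set arcs D}) (u v w : vert D).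

Lemma contract_class_eq E u v :
  (contract_class E u == contract_class E v) = connect (adj E) u v.
Proof.
rewrite -val_eqE /=; apply/eqP/idP => [eq_c|uv].
  have vv : v \in component E v by rewrite inE connect0.
  by have eqc : component E u = component E v := eq_c; rewrite -eqc inE in vv.
by apply/setP => w; rewrite !inE (same_connect (adj_connect_sym E) uv).
Qed.

Lemma contract_classP E (x : contract_vert E) : exists v, x = contract_class E v.
Proof. by have /imsetP[v _ xv] := valP x; exists v; apply: val_inj. Qed.

(** If the complement of [E] contains the directed cut of [X], then [X] is a union of classes of [E]
    and no arc enters it. Conversely, the vertices not reachable from the class of [u] form the tail
    side of a directed cut avoiding [E]. *)
Lemma contract_strongly_connected E :
  strongly_connected (contract E) <-> ~ contains_directed_cut (~: E).
Proof.
split=> [sc [C [[X [X0 XT CX Cdir]] CE]]|nodir x y].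
  have [u uX] := set0Pn _ X0.
  move: XT; rewrite -subTset => /subsetPn[v _ vX].
  have cutE a : a \in cut X -> src a \in X by rewrite -CX; apply: Cdir.
  have XE x y : connect (adj E) x y -> (x \in X) = (y \in X).
    move=> xy; apply/idP/idP => [xX|yX]; apply/negPn/negP => nX.
      have [a aE] := connect_cross xy xX nX.
      by rewrite -CX => /(subsetP CE); rewrite inE aE.
    rewrite (adj_connect_sym E) in xy.
    have [a aE] := connect_cross xy yX nX.
    by rewrite -CX => /(subsetP CE); rewrite inE aE.
  pose P (x : contract_vert E) := [exists w, (x == contract_class E w) && (w \notin X)].
  have PE w : P (contract_class E w) = (w \notin X).
    apply/existsP/idP => [[w' /andP[]]|wX]; last by exists w; rewrite eqxx.
    by rewrite contract_class_eq => /XE ->.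
  suff: P (contract_class E u) by rewrite PE uX.
  apply: connect_invariant (sc (contract_class E v) (contract_class E u)) _.
    2: by rewrite PE.
  move=> x y /existsP[[a aE] /= /andP[/eqP<- /eqP<-]]; rewrite !PE => sX.
  apply/negP => tX; have /cutE : a \in cut X by rewrite inE (negbTE sX) tX.
  by apply/negP.
have [u ->] := contract_classP x; have [v ->] := contract_classP y.
apply/negPn/negP => nuv; apply: nodir.
set R := (X in connect X) in nuv.
pose X := [set w | ~~ connect R (contract_class E u) (contract_class E w)].
have inX a : (src a \in X) != (tgt a \in X) -> a \notin E /\ src a \in X.
  move=> aX; have aE : a \notin E.
    apply: contra aX => /adj_src_tgt/connect1.
    by rewrite -contract_class_eq => /eqP eq_st; rewrite !inE eq_st.
  split=> //; apply/negPn/negP => sX; move: aX; rewrite (negbTE sX) eq_sym eqbF_neg.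
  rewrite negbK inE => /negP; apply; move: sX; rewrite inE negbK => us.
  apply: connect_trans us _; apply: connect1; apply/existsP.
  by exists (Sub a aE); rewrite /= !eqxx.
exists (cut X); split; last first.
  by apply/subsetP => a; rewrite inE => /inX[aE _]; rewrite inE.
exists X; split=> //.
- by apply/set0Pn; exists v; rewrite inE.
- by rewrite -subTset; apply/subsetPn; exists u; rewrite ?inE ?connect0.
- by move=> a; rewrite inE => /inX[].
Qed.

End Contraction.

(** * Vertex connectivity and edge cuts *)

Section Connectivity.

Variable D : digraph.
Implicit Types (X S : {set vert D}) (u v w : vert D).

(** One end of each arc of a cut with at most two arcs gives a set [S] separating [X] from the rest,
    so [S] covers a side. Taking both ends in [X], both outside, and one of each leaves at most
    three vertices in all. *)
Lemma k_connected_cut X :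
  k_connected D 3 -> X != set0 -> X != setT -> 3 <= #|cut X|.
Proof.
move=> [gt3 conn] X0 XT; rewrite leqNgt; apply/negP => lt3.
have cutP S : #|S| < 3 -> (forall a, a \in cut X -> (src a \in S) || (tgt a \in S)) ->
    (X \subset S) || (~: X \subset S).
  move=> ltS Scov; apply/negPn; rewrite negb_or; apply/andP.
  move=> -[/subsetPn[u uX uS] /subsetPn[v vX vS]].
  rewrite inE in vX; case/negP: vX.
  apply: (connect_invariant (P := fun w => w \in X)) (conn S ltS u v uS vS) uX.
  move=> x y /and3P[xS yS /adjP[[a b] _]].
  rewrite /dsrc /dtgt /= => -[ax ay] xX; apply/negPn/negP => yX.
  have /Scov : a \in cut X.
    by rewrite inE; case: b ax ay => -> ->; rewrite xX (negbTE yX).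
  by case: b ax ay => -> ->; rewrite (negbTE xS) (negbTE yS).
have [a1 [a2 [a1X a2X aX]]] : exists a1 a2,
    [/\ a1 \in cut X, a2 \in cut X & forall a, a \in cut X -> a = a1 \/ a = a2].
  move: lt3; rewrite cardE; case enumX: (enum (cut X)) => [|a1 s] lt3.
    have /orP[] : (X \subset set0) || (~: X \subset set0).
    - apply: cutP; first by rewrite cards0.
      by move=> a; rewrite -mem_enum enumX.
    - by rewrite subset0 (negbTE X0).
    by rewrite subset0 -setCT (inj_eq (@setC_inj _)) (negbTE XT).
  have memX a : (a \in cut X) = (a \in a1 :: s) by rewrite -enumX mem_enum.
  (* [a1] and [a2] coincide when the cut is a single arc. *)
  exists a1, (head a1 s); case: s lt3 memX {enumX} => [|a2 []] //= _ memX;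
    rewrite !memX !inE !eqxx ?orbT; split=> // a; rewrite memX !inE.
    by move=> /eqP; left.
  by case/orP => /eqP; [left | right].
pose x a := if src a \in X then src a else tgt a.
pose y a := if src a \in X then tgt a else src a.
have xX a : a \in cut X -> x a \in X.
  by rewrite inE /x; case: ifP => // _; case: (_ \in X).
have yX a : a \in cut X -> y a \notin X.
  by rewrite inE /y; case: ifP => [_|/negbT //]; case: (_ \in X).
have xP a : (x a == src a) || (x a == tgt a) by rewrite /x; case: ifP; rewrite eqxx ?orbT.
have yP a : (y a == src a) || (y a == tgt a) by rewrite /y; case: ifP; rewrite eqxx ?orbT.
have cutP2 u v : (u == src a1) || (u == tgt a1) -> (v == src a2) || (v == tgt a2) ->
    (X \subset [set u; v]) || (~: X \subset [set u; v]).
  move=> ua1 va2; apply: cutP; first by rewrite cards2; case: eqP.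
  by move=> a /aX[] ->; [move: ua1|move: va2];
    case/orP => /eqP <-; rewrite !inE eqxx ?orbT.
have cX : #|X| <= 2.
  have /orP[/subset_leq_card|/subsetP sub] := cutP2 _ _ (xP a1) (xP a2).
    by move=> leX; apply: leq_trans leX _; rewrite cards2; case: eqP.
  have := sub (y a1); rewrite !inE yX // => /(_ isT).
  by case/orP => /eqP eq_y; have := yX _ a1X; rewrite eq_y xX.
have cXC : #|~: X| <= 2.
  have /orP[/subsetP sub|/subset_leq_card] := cutP2 _ _ (yP a1) (yP a2).
    have := sub (x a1); rewrite !inE xX // => /(_ isT).
    by case/orP => /eqP eq_x; [have := yX _ a1X|have := yX _ a2X]; rewrite -eq_x xX.
  by move=> leX; apply: leq_trans leX _; rewrite cards2; case: eqP.
have := cardsC X; suff: (#|X| <= 1) || (#|~: X| <= 1) by lia.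
have /orP[/subsetP sub|/subsetP sub] := cutP2 _ _ (xP a1) (yP a2); apply/orP; [left|right].
  rewrite -(cards1 (x a1)) subset_leq_card //; apply/subsetP => w wX.
  have := sub w wX; rewrite !inE => /orP[//|/eqP eq_w].
  by have := yX _ a2X; rewrite -eq_w wX.
rewrite -(cards1 (y a2)) subset_leq_card //; apply/subsetP => w wX.
have := sub w wX; rewrite !inE => /orP[/eqP eq_w|//].
by move: wX; rewrite inE eq_w xX.
Qed.

(** A separating set [S] of fewer than three vertices yields a cut with at most [#|S|] arcs: each
    vertex of [S] joins the side to which it sends at least two of its three darts. *)
Lemma cubic_k_connected :
  cubic D -> (forall X, X != set0 -> X != setT -> 3 <= #|cut X|) ->
  3 < #|vert D| -> k_connected D 3.
Proof.
move=> cub cut3 gt3; split=> // S ltS u v uS vS.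
apply/negPn/negP; set R := [rel x y | _] => nuv.
pose X0 := [set w | connect R u w].
pose darts_to (Q : {set vert D}) s := [set d : dart D | (dsrc d == s) && (dtgt d \in Q)].
pose X := X0 :|: [set s in S | 2 <= #|darts_to X0 s|].
have X0S w : w \in X0 -> w \notin S.
  rewrite inE => uw.
  by apply: (connect_invariant (P := fun w => w \notin S)) uw uS => x y /and3P[].
have X0R (d : dart D) : dsrc d \in X0 -> dtgt d \notin S -> dtgt d \in X0.
  move=> dX0 dS; have sS := X0S _ dX0; rewrite !inE in dX0 *.
  apply: connect_trans dX0 _; apply: connect1; rewrite /= sS dS /=.
  by apply/adjP; exists d; rewrite ?inE.
have inX w : w \notin S -> (w \in X) = (w \in X0).
  by move=> wS; rewrite !inE (negbTE wS) /= orbF.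
have uX : u \in X by rewrite inX // inE.
have vX : v \notin X by rewrite inX // inE.
(* [Z] collects the minority darts, at most one at each vertex of [S]; every crossing arc carries
   one of them. *)
pose Z := \bigcup_(s in S) darts_to (if s \in X then ~: X0 else X0) s.
have cardZ : #|Z| <= #|S|.
  rewrite -[#|S|]sum1_card /Z.
  elim/big_ind2: _ => [|Y1 n1 Y2 n2 le1 le2|s sS]; first by rewrite cards0.
    by apply: leq_trans (leq_card_setU _ _) _; apply: leq_add.
  have cards : #|darts_to X0 s| + #|darts_to (~: X0) s| = 3.
    rewrite -(cub s) degree_darts -cardsUI.
    have -> : darts_to X0 s :&: darts_to (~: X0) s = set0.
      by apply/setP => d; rewrite !inE; case: (connect R u _); rewrite ?andbF.
    rewrite cards0 addn0.
    apply: eq_card => d; rewrite !inE /=.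
    by case: (connect R u _); rewrite ?andbF ?andbT ?orbF.
  have : (s \in X) = (2 <= #|darts_to X0 s|).
    rewrite in_setU in_set sS /=; case: (boolP (s \in X0)) => // /X0S.
    by rewrite sS.
  by case: (s \in X) => [|/esym/negbT]; lia.
have ltX : #|cut X| < 3.
  apply: leq_ltn_trans ltS; apply: leq_trans cardZ.
  suff sub : cut X \subset [set d.1 | d in Z].
    by apply: leq_trans (subset_leq_card sub) _; apply: leq_imset_card.
  apply/subsetP => a aX; suff [d dZ <-] : exists2 d : dart D, d \in Z & d.1 = a.
    exact: imset_f.
  have [d dX [da dsX]] : exists2 d : dart D, d.1 = a & dsrc d \in X /\ dtgt d \notin X.
    move: aX; rewrite inE; case: (boolP (src a \in X)) => [sX tX|sX].
      by exists (a, true).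
    by rewrite eq_sym eqbF_neg negbK => tX; exists (a, false).
  have [dS|dS] := boolP (dsrc d \in S).
    exists d => //; apply/bigcupP; exists (dsrc d) => //; rewrite da in_set eqxx /=.
    by rewrite in_setC; apply: contra dsX => dX0; rewrite in_setU dX0.
  have dX0 : dsrc d \in X0 by rewrite -inX.
  have tS : dtgt d \in S.
    by apply: contraNT dsX => tS; rewrite inX //; apply: X0R.
  exists (flip d); last by [].
  apply/bigcupP; exists (dtgt d) => //; rewrite (negbTE dsX) in_set.
  have -> : dsrc (flip d) = dtgt d by case: (d) => b [].
  have -> : dtgt (flip d) = dsrc d by case: (d) => b [].
  by rewrite eqxx.
suff: 3 <= #|cut X| by rewrite leqNgt ltX.
apply: cut3; first by apply/set0Pn; exists u.
by rewrite -subTset; apply/subsetPn; exists v.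
Qed.

End Connectivity.

(** * The prism over a digraph *)

(** Applied to [dsrc] this provides a rotation system with arbitrary cyclic orders, enough for
    building the prism. The permutation runs cyclically through the enumeration of each fibre. *)
Lemma perm_of_fibers (T : finType) (V : eqType) (f : T -> V) :
  exists s : {perm T}, forall x y, (y \in porbit s x) = (f x == f y).
Proof.
pose F x := enum [pred y | f x == f y].
have memF x y : (y \in F x) = (f x == f y) by rewrite mem_enum inE.
have eqF x y : f x = f y -> F x = F y.
  by move=> fxy; apply: eq_enum => z; rewrite !inE fxy.
pose g x := next (F x) x.
have fg x : f (g x) = f x.
  by apply/eqP; rewrite eq_sym -memF mem_next memF.
have g_inj : injective g.
  move=> x y gxy; have Fxy : F x = F y by apply: eqF; rewrite -fg gxy fg.
  move: gxy; rewrite /g Fxy => /(can_inj (prev_next (enum_uniq _))); exact.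
have fcyc x : fcycle g (F x).
  rewrite (eq_in_cycle (P := [in F x]) (e' := frel (next (F x)))).
  - exact/cycle_next/enum_uniq.
  - by move=> y z; rewrite unfold_in /= memF => /eqP/eqF Fxy _; rewrite /g -Fxy.
  - exact/allP.
exists (perm g_inj) => x y; have xF : x \in F x by rewrite memF.
rewrite -memF -(fconnect_cycle (fcyc x) xF).
apply/porbitP/idP => [[i ->]|/iter_findex <-].
  by rewrite permX (eq_iter (permE g_inj)) fconnect_iter.
by exists (findex g x y); rewrite permX (eq_iter (permE g_inj)).
Qed.

Lemma porbit_change (T : finType) (s : {perm T}) (P : pred T) x y :
  y \in porbit s x -> P x -> ~~ P y -> exists2 z, z \in porbit s x & P z && ~~ P (s z).
Proof.
case/porbitP => i ->; elim: i => [|i IHi] Px; first by rewrite perm1 Px.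
rewrite expgSr permM => nP; have [Pi|] := boolP (P ((s ^+ i)%g x)); last exact: IHi.
by exists ((s ^+ i)%g x); rewrite ?mem_porbit ?Pi.
Qed.

(** The star of a source or sink is a directed cut. This forces the even subgraphs of interest to
    meet every port of the prism. *)
Lemma source_or_sink_directed_cut (D : digraph) (E : {set arcs D}) (w : vert D) :
  (forall a, tgt a != w) \/ (forall a, src a != w) ->
  1 < #|vert D| -> degree E w = 0 -> contains_directed_cut (~: E).
Proof.
move=> dirw gt1; rewrite degree_sum => /eqP; rewrite sum_nat_eq0 => /forallP degE.
have [w' w'w] : exists w', w' != w.
  by apply/existsP; apply: contraTT gt1 => /existsPn ww; rewrite -leqNgt;
     apply/card_le1_eqP => x y _ _; have /negPn/eqP-> := ww x; have /negPn/eqP-> := ww y.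
have cutE (a : arcs D) : a \in cut [set w] -> a \in ~: E.
  rewrite !inE => aw; apply/negP => aE; have := implyP (degE a) aE.
  by move: aw; do 2!case: (_ == w).
case: dirw => dirw.
  exists (cut [set w]); split; last exact/subsetP.
  exists [set w]; split=> //; first by apply/set0Pn; exists w; rewrite inE.
    by rewrite -subTset; apply/subsetPn; exists w'; rewrite ?inE.
  by move=> a; rewrite !inE (negbTE (dirw a)); case: (_ == w).
have cutC : cut (~: [set w]) = cut [set w].
  by apply/setP => a; rewrite !inE; do 2!case: (_ == w).
exists (cut [set w]); split; last exact/subsetP.
exists (~: [set w]); split=> //; first by apply/set0Pn; exists w'; rewrite !inE.
  by rewrite -subTset; apply/subsetPn; exists w; rewrite ?inE ?negbK.
by move=> a; rewrite !inE (dirw a).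
Qed.

Lemma edge_connected_degree (D : digraph) (v : vert D) :
  k_edge_connected D 3 -> 2 < #|[set d : dart D | dsrc d == v]|.
Proof.
move=> /k_edge_connectedP[gt1 cutD].
have /card_gt0P[w wv] : 0 < #|predC1 v| by rewrite cardC1; lia.
have : 3 <= #|cut [set v]|.
  apply: cutD; first by apply/set0Pn; exists v; rewrite inE.
  by rewrite -subTset; apply/subsetPn; exists w; rewrite // inE.
move/leq_trans; apply; pose f (a : arcs D) : dart D := (a, src a == v).
rewrite -(@card_imset _ _ f) => [|a a' [] //]; apply/subset_leq_card/subsetP.
move=> _ /imsetP[a aX ->]; rewrite inE /dsrc /f /=.
move: aX; rewrite !inE; case: (boolP (src a == v)) => //= _.
by rewrite eq_sym eqbF_neg negbK.
Qed.

Lemma edge_connected_dart (D : digraph) (v : vert D) :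
  k_edge_connected D 3 -> exists d : dart D, dsrc d = v.
Proof.
move=> /(edge_connected_degree v).
case: (set_0Vmem [set d : dart D | dsrc d == v]) => [->|[d]]; first by rewrite cards0.
by rewrite inE => /eqP dv _; exists d.
Qed.

Section Prism.

Variables (D : digraph) (s : {perm dart D}).
Hypothesis rot_s : rotation_system s.

(** The summand [dart D] holds the ports, [dart D * bool] the nodes of the two rings; the arcs are
    links, rungs and ring arcs, named below. Rungs are oriented so that the port of [(a, true)] is a
    source and that of [(a, false)] a sink. *)
Definition prism : digraph :=
  @Digraph (dart D + dart D * bool)%type (arcs D + dart D * bool * bool)%type
    (fun x => match x with
      | inl a => inl (a, true)
      | inr (d, b, true) => if d.2 then inl d else inr (d, b)
      | inr (d, b, false) => inr (d, b)
      end)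
    (fun x => match x with
      | inl a => inl (a, false)
      | inr (d, b, true) => if d.2 then inr (d, b) else inl d
      | inr (d, b, false) => inr (s d, b)
      end).

Definition link (a : arcs D) : arcs prism := inl a.
Definition rung (d : dart D) (b : bool) : arcs prism := inr (d, b, true).
Definition ring (d : dart D) (b : bool) : arcs prism := inr (d, b, false).
Definition port (d : dart D) : vert prism := inl d.
Definition node (d : dart D) (b : bool) : vert prism := inr (d, b).

Lemma dsrc_rot d : dsrc (s d) = dsrc d.
Proof. by apply/eqP; rewrite eq_sym -rot_s -{1}[s]expg1 mem_porbit. Qed.

Lemma big_prism_arcs (F : arcs prism -> nat) :
  \sum_x F x = \sum_a F (link a) + \sum_d \sum_b F (rung d b) + \sum_d \sum_b F (ring d b).
Proof.
rewrite big_sumType /= -addnA; congr (_ + _).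
rewrite pair_bigA [X in _ = _ + X]pair_bigA -big_split /=.
rewrite (eq_bigr (fun p => F (inr (p.1, p.2)))) => [|[] //].
rewrite -(pair_bigA _ (fun x b => F (inr (x, b)))) /=.
by apply: eq_bigr => -[d b] _; rewrite big_bool.
Qed.

Lemma sum_delta (T : finType) (F : T -> nat) x :
  \sum_y (y == x) * F y = F x.
Proof.
by rewrite (bigD1 x) //= eqxx mul1n big1 ?addn0 // => y /negbTE->.
Qed.

Lemma degree_port (E : {set arcs prism}) d :
  degree E (port d) = (link d.1 \in E) + \sum_b (rung d b \in E).
Proof.
rewrite degree_sum big_mkcond big_prism_arcs.
rewrite [X in _ + X]big1 ?addn0 => [|d' _]; last first.
  by rewrite big1 // => b _; case: ifP.
congr (_ + _).
  rewrite -[RHS](sum_delta (fun d' : dart D => (link d'.1 \in E) : nat)).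
  rewrite -(pair_bigA _ (fun a b => ((a, b) == d) * (link a \in E))) /=.
  apply: eq_bigr => a _; rewrite big_bool /= -mulnDl.
  by rewrite -![inl _ == inl _]/(_ == _); case: (link a \in E); rewrite ?muln1 ?muln0.
rewrite -[RHS](sum_delta (fun d' : dart D => \sum_b (rung d' b \in E))).
apply: eq_bigr => d' _; rewrite big_distrr /=; apply: eq_bigr => b _.
rewrite /rung /=; case: (inr _ \in E); rewrite ?muln0 ?muln1 //.
by case: d'.2; rewrite -[inl d' == port d]/(d' == d) ?addn0 ?add0n.
Qed.

Lemma degree_node (E : {set arcs prism}) d b :
  degree E (node d b) =
  (rung d b \in E) + (ring d b \in E) + (ring ((s^-1)%g d) b \in E).
Proof.
rewrite degree_sum big_mkcond big_prism_arcs.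
rewrite [X in X + _ + _]big1 ?add0n => [|a _]; last by case: ifP.
rewrite -addnA; congr (_ + _).
  rewrite pair_bigA -(sum_delta (fun x => (rung x.1 x.2 \in E) : nat) (d, b)).
  apply: eq_bigr => -[d' b'] _ /=; case: (rung _ _ \in E); rewrite ?muln0 ?muln1 //=.
  by case: d'.2; rewrite -[inr (d', b') == _]/((d', b') == (d, b)) ?addn0 ?add0n.
have -> : \sum_d0 \sum_b0 (if ring d0 b0 \in E
    then (src (ring d0 b0) == node d b) + (tgt (ring d0 b0) == node d b) else 0) =
    \sum_(x : dart D * bool) (x == (d, b)) * (ring x.1 x.2 \in E) +
    \sum_(x : dart D * bool) (x == ((s^-1)%g d, b)) * (ring x.1 x.2 \in E).
  rewrite pair_bigA -big_split; apply: eq_bigr => -[d' b'] _ /=.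
  case: (ring _ _ \in E); rewrite ?muln0 ?muln1 //=; congr (_ + nat_of_bool _).
  rewrite -[inr _ == _]/((s d', b') == (d, b)) !xpair_eqE; congr (_ && _).
  by rewrite -(inj_eq (@perm_inj _ s) d') permKV.
by rewrite !sum_delta.
Qed.

Lemma prism_cubic : cubic prism.
Proof.
by case=> [d|[d b]]; rewrite ?degree_port ?degree_node ?big_bool !inE.
Qed.

Lemma big_at_rot v (F : dart D -> nat) :
  \sum_(d | dsrc d == v) F ((s^-1)%g d) = \sum_(d | dsrc d == v) F d.
Proof.
rewrite [RHS](reindex_inj (@perm_inj _ (s^-1)%g)) /=; apply: eq_bigl => d.
by rewrite -[in LHS](permKV s d) dsrc_rot.
Qed.

(** In the sum of the degrees around one ring every ring arc of [E] counts twice, so the parity is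
    that of the rungs. *)
Lemma prism_ring_parity (E : {set arcs prism}) v b :
  even_degrees E -> ~~ odd (\sum_(d | dsrc d == v) (rung d b \in E)).
Proof.
move=> evE; have: ~~ odd (\sum_(d | dsrc d == v) degree E (node d b)).
  by rewrite (big_morph odd oddD (erefl : odd 0 = false)) big1 // => d _; apply/negbTE/evE.
under eq_bigr => d _ do rewrite degree_node.
rewrite !big_split /= (big_at_rot v (fun d => ring d b \in E)) -addnA addnn.
by rewrite oddD odd_double addbF.
Qed.

Lemma degree_links (E : {set arcs prism}) v :
  degree [set a | link a \in E] v = \sum_(d | dsrc d == v) (link d.1 \in E).
Proof.
rewrite degree_darts -big_mkcondr /= sum1dep_card; apply: eq_card => d.
by rewrite !inE andbC.
Qed.

(** The degrees of the ports at [v] add up to the links plus the rungs to both rings, and the latter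
    are even in number. *)
Lemma prism_even_links (E : {set arcs prism}) :
  even_degrees E -> even_degrees [set a | link a \in E].
Proof.
move=> evE v; rewrite degree_links.
have: ~~ odd (\sum_(d | dsrc d == v) degree E (port d)).
  by rewrite (big_morph odd oddD (erefl : odd 0 = false)) big1 // => d _; apply/negbTE/evE.
under eq_bigr => d _ do rewrite degree_port.
rewrite big_split /= oddD exchange_big /= big_bool /= oddD.
by rewrite !(negbTE (prism_ring_parity _ _ evE)) !addbF.
Qed.

(** The collapse of the prism onto [D]; only links can join different fibres. *)
Definition prism_owner (w : vert prism) : vert D :=
  match w with inl d => dsrc d | inr (d, _) => dsrc d end.

(** The only arcs crossing the preimage of [X] under [prism_owner] are links, with the directions
    they have in [D]. *)
Lemma prism_directed_cut (E : {set arcs prism}) :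
  contains_directed_cut (~: [set a | link a \in E]) ->
  (forall v, exists d : dart D, dsrc d = v) ->
  contains_directed_cut (~: E).
Proof.
move=> [C [[X [X0 XT -> Cdir]] CE]] onto.
pose Y := [set w : vert prism | prism_owner w \in X].
have cutY x : x \in cut Y -> exists2 a, x = link a & a \in cut X.
  case: x => [a|[[d b] []]]; rewrite !inE /=; first by exists a => //; rewrite !inE.
    by case: d.2; rewrite eqxx.
  by rewrite dsrc_rot eqxx.
exists (cut Y); split; last first.
  by apply/subsetP => x /cutY[a -> /(subsetP CE)]; rewrite !inE.
exists Y; split=> //.
- have [v vX] := set0Pn _ X0; have [d dv] := onto v.
  by apply/set0Pn; exists (port d); rewrite inE /= dv.
- move: XT; rewrite -!subTset => /subsetPn[v _ vX]; have [d dv] := onto v.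
  by apply/subsetPn; exists (port d); rewrite ?inE //= dv.
by move=> x /cutY[a -> /Cdir aX]; rewrite inE.
Qed.

(** A set [X] is tested in turn for a ring with nodes on both sides, for a vertex of [D] whose two
    rings are on different sides, and for a port on the other side than its rings. Each exception
    gives three crossing arcs; without exceptions [X] comes from a cut of [D]. *)
Lemma prism_k_edge_connected : k_edge_connected D 3 -> k_edge_connected prism 3.
Proof.
move=> conn; have /k_edge_connectedP[gt1 cutD] := conn.
have deg3 v := edge_connected_degree v conn; have onto v := edge_connected_dart v conn.
have gt0 : 0 < #|vert D| by lia.
have [v0 _] := card_gt0P gt0; have [d0 _] := onto v0.
apply/k_edge_connectedP; split.
  apply/card_gt1P; exists (node d0 true), (node d0 false); split=> //.
  by apply/eqP => -[].
move=> X X0 XT.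
pose R b d := node d b \in X; pose p d := port d \in X.
have ring_cut d b : (ring d b \in cut X) = (R b d != R b (s d)) by rewrite inE.
have rung_cut d b : (rung d b \in cut X) = (p d != R b d).
  by rewrite inE /=; case: d => a []; rewrite // eq_sym.
have link_cut a : (link a \in cut X) = (p (a, true) != p (a, false)) by rewrite inE.
have changes b d d' : dsrc d = dsrc d' -> R b d -> ~~ R b d' ->
    exists z z', [/\ z != z', ring z b \in cut X & ring z' b \in cut X].
  move=> dd' Rd Rd'; have: d' \in porbit s d by rewrite rot_s dd'.
  case/(porbit_change (P := R b)) => // z _ /andP[Rz Rsz].
  have: d \in porbit s d' by rewrite rot_s dd'.
  case/(porbit_change (P := fun x => ~~ R b x)) => //; first by rewrite negbK.
  move=> z' _ /andP[Rz' /negPn Rsz']; exists z, z'; rewrite !ring_cut.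
  rewrite Rz (negbTE Rz') Rsz' (negbTE Rsz); split=> //.
  by apply: contraNneq Rz' => <-.
have [/existsP[b /existsP[d /existsP[d' /and3P[/eqP dd' Rd Rd']]]]|nochange] :=
  boolP [exists b, exists d, exists d', [&& dsrc d == dsrc d', R b d & ~~ R b d']].
  have [z [z' [zz' cz cz']]] := changes _ _ _ dd' Rd Rd'.
  (* Two arcs of this ring cross. A third is a rung if the other ring differs at [d] or [d'], and
     otherwise an arc of that other ring. *)
  suff [x cx xb] : exists2 x, x \in cut X & forall y, x != ring y b.
    apply/card_gt2P; exists (ring z b), (ring z' b), x; split=> //; split; last exact: xb.
      by apply: contra zz' => /eqP[->].
    by rewrite eq_sym xb.
  have cross e : R b e != R (~~ b) e -> exists2 x, x \in cut X & forall y, x != ring y b.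
    move=> Re; have: (rung e b \in cut X) || (rung e (~~ b) \in cut X).
      by rewrite !rung_cut; move: Re; case: (p e); case: (R b e); case: (R _ e).
    by case/orP => ce; [exists (rung e b) | exists (rung e (~~ b))] => // y; apply/eqP => -[].
  have [Rbd|/cross//] := eqVneq (R b d) (R (~~ b) d).
  have [Rbd'|/cross//] := eqVneq (R b d') (R (~~ b) d').
  have [|||y [_ [_ cy _]]] := changes (~~ b) d d'; rewrite -?Rbd -?Rbd' //.
  exists (ring y (~~ b)) => // y'; apply/eqP => -[_]; by case: (b).
have Rconst b d d' : dsrc d = dsrc d' -> R b d = R b d'.
  move=> dd'; have half e e' : dsrc e = dsrc e' -> R b e -> R b e'.
    move=> ee' Re; apply: contraNT nochange => Re'.
    by apply/existsP; exists b; apply/existsP; exists e; apply/existsP; exists e';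
      rewrite ee' eqxx Re.
  by apply/idP/idP; apply: half.
have [/existsP[d Rd]|/existsPn same] := boolP [exists d, R true d != R false d].
  (* The two rings of this vertex are on different sides, so each of its at least three ports has a
     crossing rung. *)
  apply: leq_trans (deg3 (dsrc d)) _.
  pose f d := rung d (p d == R false d).
  rewrite -(@card_imset _ _ f) => [|x y [] //]; apply/subset_leq_card/subsetP.
  move=> _ /imsetP[e + ->]; rewrite inE => /eqP ed.
  move: Rd; rewrite -!(Rconst _ _ _ ed) rung_cut.
  by case: (p e); case E1: (R true e); case E2: (R false e); rewrite /= ?E1 ?E2.
have {}same d : R true d = R false d by apply/eqP/negPn/same.
pose Y := [set dsrc d | d in R true].
have inY d : (dsrc d \in Y) = R true d.
  apply/imsetP/idP => [[e Re ed]|Rd]; last by exists d.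
  by rewrite (Rconst _ _ _ ed).
have rungY d b : (rung d b \in cut X) = (p d != (dsrc d \in Y)).
  by rewrite rung_cut inY; case: b; rewrite // same.
have [/existsP[d pd]|/existsPn pY] := boolP [exists d, p d != (dsrc d \in Y)].
  (* Both rungs of this port cross. The third arc is a rung of another such port, the link of [d],
     or the link of a further arc of [cut Y], which in this last case contains [d.1]. *)
  suff [x cx xd] : exists2 x, x \in cut X & forall b, x != rung d b.
    apply/card_gt2P; exists (rung d true), (rung d false), x; rewrite !rungY.
    by split=> //; split; rewrite ?xd // eq_sym ?xd //; apply/eqP => -[].
  have [/existsP[e /andP[ed pe]]|/existsPn one] :=
    boolP [exists e, (e != d) && (p e != (dsrc e \in Y))].
    exists (rung e true); first by rewrite rungY.
    by move=> b; apply: contra ed => /eqP[->].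
  have {}one e : e != d -> p e = (dsrc e \in Y).
    by move=> ed; have := one e; rewrite ed /= negbK => /eqP.
  have [cd|] := boolP (link d.1 \in cut X); first by exists (link d.1).
  have -> : (link d.1 \in cut X) = (p d != p (flip d)).
    by rewrite link_cut; case: (d) => a []; rewrite // eq_sym.
  have fd : flip d != d by case: (d) => a []; apply/eqP => -[].
  rewrite negbK (one _ fd) => /eqP pfd.
  have cY : d.1 \in cut Y.
    move: pd; rewrite pfd inE; case: (d) => a []; rewrite /flip /dsrc //= eq_sym //.
  have [a [ac ad]] : exists a, a \in cut Y /\ a != d.1.
    have : 3 <= #|cut Y|.
      apply: cutD; apply: contraTneq cY => ->; rewrite !inE //.
    rewrite (cardsD1 d.1) cY; case: (set_0Vmem (cut Y :\ d.1)) => [->|[a]].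
      by rewrite cards0.
    by rewrite !inE => /andP[ad aY] _; exists a; rewrite inE.
  exists (link a) => //; rewrite link_cut !one; first by rewrite inE in ac.
    by apply: contraNneq ad => <-.
  by apply: contraNneq ad => <-.
have {}pY d : p d = (dsrc d \in Y) by apply/eqP/negPn/pY.
have: 3 <= #|cut Y|.
  apply: cutD.
    case/set0Pn: X0 => -[d dX|[d b] dX]; apply/set0Pn; exists (dsrc d).
      by rewrite -pY.
    by rewrite inY; case: b dX => // dX; rewrite same.
  move: XT; rewrite -!subTset => /subsetPn[[d|[d b]] _ dX]; apply/subsetPn; exists (dsrc d).
  - by [].
  - by rewrite -pY.
  - by [].
  - by rewrite inY; case: b dX => // dX; rewrite same.
move/leq_trans; apply; rewrite -(@card_imset _ _ link) => [|a a' [] //].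
apply/subset_leq_card/subsetP => _ /imsetP[a aY ->].
by rewrite link_cut !pY; rewrite inE in aY.
Qed.

End Prism.

(** * The equivalence for even subgraphs and matchings *)

Lemma degree_setC (D : digraph) (F : {set arcs D}) v :
  degree F v + degree (~: F) v = degree setT v.
Proof.
rewrite !degree_sum [RHS](bigID (mem F)) /=; congr (_ + _); apply: eq_bigl => a.
  by rewrite !inE.
by rewrite !inE.
Qed.

Lemma even_subgraph_iff_matching :
  (forall D : digraph, k_edge_connected D 3 ->
      exists E : {set arcs D}, even_subgraph E /\ strongly_connected (contract E))
   <->
   (forall D : digraph, k_edge_connected D 3 -> cubic D ->
      exists M : {set arcs D}, perfect_matching M /\ ~ contains_directed_cut M).
Proof.
split=> [evenP D conn cub|matchP D conn].
  have [s rot_s] := perm_of_fibers (@dsrc D).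
  have onto v := edge_connected_dart v conn.
  have conn' := prism_k_edge_connected rot_s conn.
  have [E' [/even_subgraphP evE' /contract_strongly_connected noCut]] := evenP _ conn'.
  have evE := prism_even_links rot_s evE'.
  exists (~: [set a | link s a \in E']); split; last first.
    by move=> /(prism_directed_cut rot_s)/(_ onto)/noCut.
  move=> v; have := degree_setC [set a | link s a \in E'] v.
  (* The degree is even and at most 3, so being positive it is 2, which leaves 1 for the
     complement. *)
  rewrite cub; have := evE v; suff: 0 < degree [set a | link s a \in E'] v by lia.
  (* If no link at [v] is in [E'], every port there has both rungs in [E']: its degree in [E'] is
     even, and not 0 because its star is a directed cut. A ring would then meet three rungs of
     [E']. *)
  rewrite lt0n; apply/eqP => deg0; have := prism_ring_parity rot_s v true evE'.
  rewrite (eq_bigr (fun=> 1)) => [|d /eqP dv].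
    rewrite sum1dep_card (_ : #|_| = 3) // -(cub v) degree_darts.
    by apply: eq_card => d; rewrite !inE.
  have link0 : link s d.1 \in E' = false.
    apply/negbTE/negP => dE; move: deg0; rewrite degree_links => /eqP.
    rewrite sum_nat_eq0 => /forallP/(_ d); rewrite dv eqxx dE //.
  have deg_port : degree E' (port s d) != 0.
    apply/eqP => degp; apply: noCut; apply: (source_or_sink_directed_cut _ _ degp).
      case: d {dv link0 degp} => a b; case: b; [left | right].
        by case=> [a'|[[[a' []] b] []]] //=; apply/eqP => -[].
      by case=> [a'|[[[a' []] b] []]] //=; apply/eqP => -[].
    by case/k_edge_connectedP: conn'.
  have := evE' (port s d); move: deg_port; rewrite degree_port link0 big_bool /=.
  by case: (rung _ _ _ \in E'); case: (rung _ _ _ \in E').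
have [s rot_s] := perm_of_fibers (@dsrc D).
have onto v := edge_connected_dart v conn.
have [M [perfM noCut]] := matchP _ (prism_k_edge_connected rot_s conn) (@prism_cubic D s).
have evM : even_degrees (~: M).
  by move=> w; have := degree_setC M w; rewrite perfM prism_cubic add1n => -[->].
exists [set a | link s a \in ~: M]; split.
  by apply/even_subgraphP/(prism_even_links rot_s).
apply/contract_strongly_connected => /(prism_directed_cut rot_s)/(_ onto).
by rewrite setCK.
Qed.

(** * Maps, Euler's formula and potentials *)

Section Reversal.

Variable A : finType.

(** [flip] over a bare type of arcs, so that maps can be treated apart from any [digraph]. *)
Definition rev_dart (d : A * bool) : A * bool := (d.1, ~~ d.2).

Lemma rev_dartK : involutive rev_dart.
Proof. by case=> a b; rewrite /rev_dart negbK. Qed.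

Definition rev_perm : {perm A * bool} := perm (inv_inj rev_dartK).

Lemma rev_permE d : rev_perm d = rev_dart d.
Proof. exact: permE. Qed.

Lemma rev_dart_neq d : rev_dart d != d.
Proof. by case: d => a []; apply/eqP => -[]. Qed.

Lemma big_darts (R : nmodType) (f : A * bool -> R) :
  (\sum_d f d = \sum_a (f (a, true) + f (a, false)))%R.
Proof.
rewrite (eq_bigr (fun d => f (d.1, d.2))) => [|[] //].
by rewrite -(pair_bigA _ (fun a b => f (a, b))); apply: eq_bigr => a _; rewrite big_bool.
Qed.

End Reversal.

Lemma big_enum_val_all (R : nmodType) (T : finType) (F : T -> R) :
  (\sum_(i < #|T|) F (enum_val i) = \sum_x F x)%R.
Proof.
rewrite [RHS](reindex (@enum_val T predT)) //.
exact: onW_bij (@enum_val_bij T).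
Qed.


Section Incidence.

Local Open Scope ring_scope.

Variables (R : fieldType) (A V : finType) (f : A * bool -> V).

Definition boundary (a : A) (v : V) : R :=
  (f (a, true) == v)%:R - (f (a, false) == v)%:R.

Definition incidence : 'M[R]_(#|V|, #|A|) :=
  \matrix_(i, j) boundary (enum_val j) (enum_val i).

Lemma sum_boundary (h : V -> R) a :
  \sum_v h v * boundary a v = h (f (a, true)) - h (f (a, false)).
Proof.
have delta w : \sum_v h v * (w == v)%:R = h w.
  rewrite (bigD1 w) //= eqxx mulr1 big1 ?addr0 // => v /negbTE.
  by rewrite eq_sym => ->; rewrite mulr0.
by under eq_bigr => v _ do rewrite mulrBr; rewrite big_split /= sumrN !delta.
Qed.

Lemma potential_incidence (h : 'rV[R]_#|V|) j :
  (h *m incidence) 0 j =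
  h 0 (enum_rank (f (enum_val j, true))) - h 0 (enum_rank (f (enum_val j, false))).
Proof.
rewrite -(sum_boundary (fun v => h 0 (enum_rank v))) mxE.
rewrite -[RHS]big_enum_val_all.
by apply: eq_bigr => i _; rewrite enum_valK mxE.
Qed.

(** A row in the left kernel is a potential constant along every arc. The hypothesis, which
    expresses connectedness, makes it constant, so this kernel has dimension at most 1. *)
Lemma incidence_rank :
  (forall h : V -> R, (forall a, h (f (a, true)) = h (f (a, false))) ->
     forall v w, h v = h w) ->
  (#|V| <= \rank incidence + 1)%N.
Proof.
move=> conn; have: (kermx incidence <= (const_mx 1 : 'rV[R]_#|V|))%MS.
  apply/rV_subP => h /sub_kermxP h0.
  have eq_h v w : h 0 (enum_rank v) = h 0 (enum_rank w).
    apply: (conn (fun v => h 0 (enum_rank v))) => a; apply/eqP; rewrite -subr_eq0.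
    by have := potential_incidence h (enum_rank a); rewrite enum_rankK h0 mxE => <-.
  have [V0|/card_gt0P[v _]] := posnP #|V|.
    by rewrite (_ : h = 0) ?sub0mx //; apply/rowP => i; exfalso; have := ltn_ord i; lia.
  suff -> : h = h 0 (enum_rank v) *: const_mx 1 by rewrite scalemx_sub.
  by apply/rowP => i; rewrite !mxE mulr1 -[i in LHS]enum_valK.
move/mxrankS; rewrite mxrank_ker => le1; rewrite -leq_subLR.
by apply: leq_trans le1 (rank_leq_row _).
Qed.

End Incidence.

Section Maps.

Variables (A V F : finType) (n : A * bool -> V) (p : A * bool -> F).
Variable s : {perm A * bool}.

(** Vertices and faces enter as labellings [n] and [p] of the darts, so that duality just exchanges
    them. The last field says that reversal and [s] act transitively: an invariant predicate is
    constant. *)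
Record connected_map : Prop := ConnectedMap {
  node_orbit : forall d d', (d' \in porbit s d) = (n d == n d');
  face_orbit : forall d d', (d' \in porbit (rev_perm A * s) d) = (p d == p d');
  node_onto : forall v, exists d, n d = v;
  face_onto : forall f, exists d, p d = f;
  map_connected : forall P : pred (A * bool),
    (forall d, P (rev_dart d) = P d) -> (forall d, P (s d) = P d) ->
    forall d d', P d = P d'
}.

Hypothesis mapM : connected_map.

Lemma node_rot d : n (s d) = n d.
Proof.
by apply/eqP; rewrite eq_sym -(node_orbit mapM) -{1}[s]expg1 mem_porbit.
Qed.

Lemma face_rot d : p (s d) = p (rev_dart d).
Proof.
apply/eqP; rewrite eq_sym -(face_orbit mapM).
have -> : s d = (rev_perm A * s)%g (rev_dart d) by rewrite permM rev_permE rev_dartK.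
by rewrite -{1}[(_ * s)%g]expg1 mem_porbit.
Qed.

Section Potential.

Local Open Scope ring_scope.

Variable R : fieldType.

(** Written as a sum over darts, the two halves cancel after reindexing by [s], because
    [n (s d) = n d] and [p (s d) = p (rev_dart d)]. *)
Lemma boundary_orthogonal v f :
  \sum_a boundary R n a v * boundary R p a f = 0.
Proof.
transitivity (\sum_d (n d == v)%:R * ((p d == f)%:R - (p (rev_dart d) == f)%:R) : R).
  rewrite big_darts; apply: eq_bigr => a _; rewrite /boundary /rev_dart /=.
  by rewrite mulrBl; congr (_ + _); rewrite -mulrN opprB.
under eq_bigr => d _ do rewrite mulrBr.
rewrite big_split /= sumrN; apply/eqP; rewrite subr_eq0; apply/eqP.
rewrite (reindex_inj (@perm_inj _ s)) /=.
by apply: eq_bigr => d _; rewrite node_rot face_rot.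
Qed.

Lemma incidence_orthogonal : incidence R n *m (incidence R p)^T = 0.
Proof.
apply/matrixP => i k; rewrite !mxE -[RHS](boundary_orthogonal (enum_val i) (enum_val k)).
rewrite -[RHS]big_enum_val_all.
by apply: eq_bigr => j _; rewrite !mxE.
Qed.

Lemma node_incidence_rank : (#|V| <= \rank (incidence R n) + 1)%N.
Proof.
apply: incidence_rank => h hA v w.
have [d <-] := node_onto mapM v; have [d' <-] := node_onto mapM w.
apply/eqP; rewrite -(map_connected mapM (P := fun e => h (n d) == h (n e)) _ _ d) => [|e|e].
- exact: eqxx.
- by case: e => a []; rewrite /rev_dart /= hA.
- by rewrite node_rot.
Qed.

Lemma face_incidence_rank : (#|F| <= \rank (incidence R p) + 1)%N.
Proof.
apply: incidence_rank => h hA v w.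
have [d <-] := face_onto mapM v; have [d' <-] := face_onto mapM w.
have hrev e : h (p (rev_dart e)) = h (p e) by case: e => a []; rewrite /rev_dart /= hA.
apply/eqP; rewrite -(map_connected mapM (P := fun e => h (p d) == h (p e)) _ _ d) => [|e|e].
- exact: eqxx.
- by rewrite hrev.
- by rewrite face_rot hrev.
Qed.

Lemma incidence_ranks : (\rank (incidence R n) + \rank (incidence R p) <= #|A|)%N.
Proof.
have /mxrankS : (incidence R n <= kermx (incidence R p)^T)%MS.
  exact/sub_kermxP/incidence_orthogonal.
by rewrite mxrank_ker mxrank_tr; have := rank_leq_col (incidence R p); lia.
Qed.

(** Euler's formula makes the rank bounds [#|V| - 1] and [#|F| - 1] add up to at least [#|A|], so
    the row space of the vertex incidences is the whole orthogonal complement of that of the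
    faces. *)
Lemma potential_of_circulation (g : A -> R) :
  (#|A| + 2 <= #|V| + #|F|)%N -> (forall f, \sum_a g a * boundary R p a f = 0) ->
  exists h : V -> R, forall a, g a = h (n (a, true)) - h (n (a, false)).
Proof.
move=> euler g0.
have sub : (incidence R n <= kermx (incidence R p)^T)%MS.
  exact/sub_kermxP/incidence_orthogonal.
have : (incidence R n == kermx (incidence R p)^T)%MS.
  rewrite -(mxrank_leqif_eq sub) mxrank_ker mxrank_tr.
  have := node_incidence_rank; have := face_incidence_rank; have := incidence_ranks.
  by have := rank_leq_col (incidence R p); lia.
case/andP=> _ kerS.
have: (\row_j g (enum_val j) <= incidence R n)%MS.
  apply: submx_trans kerS; apply/sub_kermxP/rowP => k; rewrite !mxE -[RHS](g0 (enum_val k)).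
  by rewrite -[RHS]big_enum_val_all; apply: eq_bigr => j _; rewrite !mxE.
case/submxP => h /rowP eq_h; exists (fun v => h 0 (enum_rank v)) => a.
by have := eq_h (enum_rank a); rewrite mxE potential_incidence enum_rankK.
Qed.

End Potential.

(** The genus is nonnegative: orthogonal row spaces have ranks adding up to at most [#|A|]. *)
Lemma euler_le : #|V| + #|F| <= #|A| + 2.
Proof.
have := node_incidence_rank rat; have := face_incidence_rank rat.
by have := incidence_ranks rat; lia.
Qed.

End Maps.

(** Composing with the reversal twice gives [s] back, so the faces of the dual are the old
    vertices. *)
Lemma dual_map (A V F : finType) (n : A * bool -> V) (p : A * bool -> F) s :
  connected_map n p s -> connected_map p n (rev_perm A * s)%g.
Proof.
have rev2 : (rev_perm A * (rev_perm A * s))%g = s.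
  by apply/permP => d; rewrite !permM !rev_permE rev_dartK.
case=> nP pP non pon conn; split=> //; first by rewrite rev2.
move=> P Pr Ps; apply: conn => // d.
by have := Ps (rev_dart d); rewrite permM rev_permE rev_dartK Pr.
Qed.

(** * The refinement of a map *)

Section Orbits.

Variables (T : finType) (t : {perm T}).

Definition orbit_type : finType := {X : {set T} | X \in porbits t}.

Definition orbit_of (x : T) : orbit_type := Sub (porbit t x) (imset_f (porbit t) (isT : x \in T)).

Lemma orbit_ofP x y : (y \in porbit t x) = (orbit_of x == orbit_of y).
Proof. by rewrite -val_eqE /= eq_porbit_mem porbit_sym. Qed.

Lemma orbit_of_onto (f : orbit_type) : exists x, orbit_of x = f.
Proof. by have /imsetP[x _ fx] := valP f; exists x; apply: val_inj. Qed.

Lemma card_orbit_type : #|orbit_type| = #|porbits t|.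
Proof. by rewrite card_sig. Qed.

Lemma porbit_step x : porbit t (t x) = porbit t x.
Proof. by have := porbit_perm t 1 x; rewrite expg1. Qed.

Hypotheses (t3 : forall x, t (t (t x)) = x) (t_fix : forall x, t x != x).

Lemma porbit3 x : porbit t x = [set x; t x; t (t x)].
Proof.
apply/setP => y; rewrite !inE; apply/porbitP/idP => [[i ->]|].
  elim: i => [|i IHi]; first by rewrite perm1 eqxx.
  by rewrite expgSr permM; case/orP: IHi => [/orP[]|] /eqP->; rewrite ?t3 eqxx ?orbT.
case/orP => [/orP[]|] /eqP->; [exists 0 | exists 1 | exists 2] => //; first by rewrite perm1.
by rewrite expgS permM.
Qed.

Lemma card_porbit3 x : #|porbit t x| = 3.
Proof.
have tt : t (t x) != x by rewrite -(inj_eq (@perm_inj _ t)) t3 eq_sym.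
rewrite porbit3 -setUA !cardsU1 cards1 !inE negb_or.
by rewrite (eq_sym x (t x)) (eq_sym x (t (t x))) (eq_sym (t x) (t (t x))) tt !t_fix.
Qed.

Lemma card_porbits3 : #|porbits t| * 3 = #|T|.
Proof.
have partO : partition (porbits t) [set: T].
  rewrite (_ : porbits t = preim_partition (porbit t) setT).
    exact: preim_partitionP.
  apply/setP => X; apply/imsetP/imsetP => -[x _ ->]; exists x => //; last first.
    by apply/setP => y; rewrite !inE eq_porbit_mem porbit_sym.
  by apply/setP => y; rewrite !inE eq_porbit_mem porbit_sym.
rewrite -cardsT (card_uniform_partition _ partO (n := 3)) // => _ /imsetP[x _ ->].
exact: card_porbit3.
Qed.

End Orbits.

Section Refinement.

Variables (A V F : finType) (n : A * bool -> V) (p : A * bool -> F).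
Variables (s : {perm A * bool}) (r : A -> bool).
Hypothesis mapM : connected_map n p s.

Let phi : {perm A * bool} := (rev_perm A * s)%g.

Lemma phiE d : phi d = s (rev_dart d).
Proof. by rewrite permM rev_permE. Qed.

(** Four arcs join the new vertex beside a dart [d] to the source of [d], its target, the next ring
    vertex and the centre. The first two are oriented by [d.2], so that [old d], [from_tgt d] and
    [to_src d] carry the same boolean and bound a directed triangle when the old arc is kept; the
    ring arcs all run along the face. *)
Definition ref_arc : finType := (A + (A * bool) * (bool * bool))%type.
Definition ref_dart : finType := (ref_arc * bool)%type.
Definition ref_node : finType := (V + A * bool + F)%type.

Definition old (d : A * bool) : ref_dart := (inl d.1, d.2).
Definition from_src (d : A * bool) : ref_dart := (inr (d, (false, false)), ~~ d.2).
Definition to_src (d : A * bool) : ref_dart := (inr (d, (false, false)), d.2).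
Definition from_tgt (d : A * bool) : ref_dart := (inr (d, (false, true)), d.2).
Definition to_tgt (d : A * bool) : ref_dart := (inr (d, (false, true)), ~~ d.2).
Definition ring_next (d : A * bool) : ref_dart := (inr (d, (true, false)), true).
Definition ring_prev (d : A * bool) : ref_dart := (inr (d, (true, false)), false).
Definition to_centre (d : A * bool) : ref_dart := (inr (d, (true, true)), true).
Definition from_centre (d : A * bool) : ref_dart := (inr (d, (true, true)), false).

(** A case analysis over the names above, which hides the dependence of orientations on [d.2]. *)
Variant ref_dart_spec : ref_dart -> Type :=
  | RefOld d : ref_dart_spec (old d)
  | RefFromSrc d : ref_dart_spec (from_src d)
  | RefToSrc d : ref_dart_spec (to_src d)
  | RefFromTgt d : ref_dart_spec (from_tgt d)
  | RefToTgt d : ref_dart_spec (to_tgt d)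
  | RefRingNext d : ref_dart_spec (ring_next d)
  | RefRingPrev d : ref_dart_spec (ring_prev d)
  | RefToCentre d : ref_dart_spec (to_centre d)
  | RefFromCentre d : ref_dart_spec (from_centre d).

Lemma ref_dartP x : ref_dart_spec x.
Proof.
case: x => -[a|[[a c] [[] []]]] b; first exact: (RefOld (a, b)).
- by case: b; constructor.
- by case: b; constructor.
- by case: c b => -[];
    [exact: RefFromTgt (a, true) | exact: RefToTgt (a, true)
    |exact: RefToTgt (a, false) | exact: RefFromTgt (a, false)].
- by case: c b => -[];
    [exact: RefToSrc (a, true) | exact: RefFromSrc (a, true)
    |exact: RefFromSrc (a, false) | exact: RefToSrc (a, false)].
Qed.

(* The three triangles at a dart [d], with x_d the new vertex beside [d]:
   (src d, tgt d, x_d), (tgt d, x_(phi d), x_d) and (x_d, x_(phi d), centre).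
   If [r] holds, the arc below [d] is exchanged for the other diagonal of the
   quadrilateral formed by the triangles of the first kind at its two darts. *)
Definition ref_face_fun (x : ref_dart) : ref_dart :=
  match x.1 with
  | inl a => if r a then to_src (a, x.2) else from_tgt (a, x.2)
  | inr (d, (false, false)) =>
      if x.2 == d.2 then if r d.1 then from_tgt (rev_dart d) else old d
      else ring_prev (phi^-1 d)%g
  | inr (d, (false, true)) =>
      if x.2 == d.2 then if r d.1 then old (rev_dart d) else to_src d
      else from_src (phi d)
  | inr (d, (true, false)) => if x.2 then to_centre (phi d) else to_tgt d
  | inr (d, (true, true)) => if x.2 then from_centre (phi^-1 d)%g else ring_next d
  end.

Definition ref_src (x : ref_dart) : ref_node :=
  match x.1 with
  | inl a => if r a then inl (inr (rev_dart (a, x.2))) else inl (inl (n (a, x.2)))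
  | inr (d, (false, false)) => if x.2 == d.2 then inl (inr d) else inl (inl (n d))
  | inr (d, (false, true)) =>
      if x.2 == d.2 then inl (inl (n (rev_dart d))) else inl (inr d)
  | inr (d, (true, false)) => if x.2 then inl (inr d) else inl (inr (phi d))
  | inr (d, (true, true)) => if x.2 then inl (inr d) else inr (p d)
  end.

Lemma ref_face_fun_spec :
  (forall d, ref_face_fun (old d) = if r d.1 then to_src d else from_tgt d) *
  (forall d, ref_face_fun (from_src d) = ring_prev (phi^-1 d)%g) *
  (forall d, ref_face_fun (to_src d) = if r d.1 then from_tgt (rev_dart d) else old d) *
  (forall d, ref_face_fun (from_tgt d) = if r d.1 then old (rev_dart d) else to_src d) *
  (forall d, ref_face_fun (to_tgt d) = from_src (phi d)) *
  (forall d, ref_face_fun (ring_next d) = to_centre (phi d)) *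
  (forall d, ref_face_fun (ring_prev d) = to_tgt d) *
  (forall d, ref_face_fun (to_centre d) = from_centre (phi^-1 d)%g) *
  (forall d, ref_face_fun (from_centre d) = ring_next d).
Proof. by do !split; case=> a []. Qed.

Lemma ref_src_spec :
  (forall d, ref_src (old d) =
     if r d.1 then inl (inr (rev_dart d)) else inl (inl (n d))) *
  (forall d, ref_src (from_src d) = inl (inl (n d))) *
  (forall d, ref_src (to_src d) = inl (inr d)) *
  (forall d, ref_src (from_tgt d) = inl (inl (n (rev_dart d)))) *
  (forall d, ref_src (to_tgt d) = inl (inr d)) *
  (forall d, ref_src (ring_next d) = inl (inr d)) *
  (forall d, ref_src (ring_prev d) = inl (inr (phi d))) *
  (forall d, ref_src (to_centre d) = inl (inr d)) *
  (forall d, ref_src (from_centre d) = inr (p d)).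
Proof. by do !split; case=> a []. Qed.

Lemma ref_rev_spec :
  (forall d, rev_dart (old d) = old (rev_dart d)) *
  (forall d, rev_dart (from_src d) = to_src d) *
  (forall d, rev_dart (to_src d) = from_src d) *
  (forall d, rev_dart (from_tgt d) = to_tgt d) *
  (forall d, rev_dart (to_tgt d) = from_tgt d) *
  (forall d, rev_dart (ring_next d) = ring_prev d) *
  (forall d, rev_dart (ring_prev d) = ring_next d) *
  (forall d, rev_dart (to_centre d) = from_centre d) *
  (forall d, rev_dart (from_centre d) = to_centre d).
Proof. by do !split; case=> a []. Qed.

Lemma ref_face_fun3 x : ref_face_fun (ref_face_fun (ref_face_fun x)) = x.
Proof.
have E := ref_face_fun_spec; case: (ref_dartP x) => d; rewrite !E ?permK ?permKV //.
- by case: ifP => rd; rewrite !E rd !E /= rd ?rev_dartK.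
- by case: ifP => rd; rewrite !E /= rd !E ?rev_dartK /= ?rd.
- by case: ifP => rd; rewrite !E /= rd !E /= ?rd ?rev_dartK.
Qed.

Definition ref_face : {perm ref_dart} :=
  perm (can_inj (f := ref_face_fun) (g := ref_face_fun \o ref_face_fun) ref_face_fun3).

(** The faces are prescribed and the rotation is recovered from them, composition with the reversal
    being an involution. *)
Definition ref_rot : {perm ref_dart} := (rev_perm ref_arc * ref_face)%g.

Lemma ref_faceE x : ref_face x = ref_face_fun x.
Proof. exact: permE. Qed.

Lemma ref_rotE x : ref_rot x = ref_face_fun (rev_dart x).
Proof. by rewrite permM rev_permE ref_faceE. Qed.

Lemma ref_rot_face : (rev_perm ref_arc * ref_rot)%g = ref_face.
Proof. by apply/permP => x; rewrite !permM !rev_permE rev_dartK. Qed.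

Lemma ref_face3 x : ref_face (ref_face (ref_face x)) = x.
Proof. by rewrite !ref_faceE ref_face_fun3. Qed.

Lemma ref_face_fix x : ref_face x != x.
Proof.
rewrite ref_faceE; have E := ref_face_fun_spec.
case: (ref_dartP x) => d; rewrite E; apply/eqP; try (by case: ifP => _ []).
all: by case.
Qed.

Definition ref_face_of : ref_dart -> orbit_type ref_face := orbit_of ref_face.

Lemma ref_src_rot x : ref_src (ref_rot x) = ref_src x.
Proof.
rewrite ref_rotE; have E := ref_face_fun_spec; have S := ref_src_spec.
case: (ref_dartP x) => d; rewrite ref_rev_spec !E ?S ?permK ?permKV //.
- by rewrite /=; case: ifP => rd; rewrite S ?rev_dartK.
- by case: ifP => rd; rewrite !S ?rev_dartK ?rd.
- by rewrite phiE (node_rot mapM).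
- by case: ifP => rd; rewrite !S ?rev_dartK /= ?rd.
- apply: congr1; apply/eqP; rewrite -(face_orbit mapM) porbit_sym.
  by rewrite -porbitV -{1}[(_ ^-1)%g]expg1 mem_porbit.
Qed.

Lemma ref_map : connected_map ref_src ref_face_of ref_rot.
Proof.
have E := ref_face_fun_spec; have S := ref_src_spec; have Rv := ref_rev_spec.
pose o := porbit ref_rot.
(* The face successor of [x] follows [rev_dart x] in the rotation; all identifications of orbits
   below come from this. *)
have step x : o (ref_face_fun x) = o (rev_dart x).
  by rewrite /o -(porbit_step ref_rot (rev_dart x)) ref_rotE rev_dartK.
have o_eq x y : o x = o y -> y \in porbit ref_rot x.
  by move=> oxy; rewrite -eq_porbit_mem eq_sym; apply/eqP.
have oX1 d : o (to_src d) = o (to_centre d).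
  have := step (from_src d); rewrite E Rv => <-.
  have := step (ring_next (phi^-1 d)%g); rewrite E Rv => <-.
  by rewrite permKV.
have oX2 d : o (ring_next d) = o (to_centre d).
  by have := step (from_centre d); rewrite E Rv.
have oX3 d : o (to_tgt d) = o (to_centre d).
  by have := step (ring_prev d); rewrite E Rv oX2.
have oX4 d : o (ring_prev d) = o (to_centre (phi d)).
  by have := step (ring_next d); rewrite E Rv.
have oV1 d : o (from_tgt d) = o (from_src (phi d)).
  by have := step (to_tgt d); rewrite E Rv.
have oold d : o (old d) = if r d.1 then o (to_centre (rev_dart d)) else o (from_src d).
  case: ifP => rd; last by have := step (to_src d); rewrite E Rv rd.
  by have := step (from_tgt (rev_dart d)); rewrite E Rv /= rd rev_dartK oX3.
have oV2 d : o (from_src (s d)) = o (from_src d).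
  have -> : s d = phi (rev_dart d) by rewrite phiE rev_dartK.
  rewrite -oV1; have := step (to_src d); rewrite E Rv; case: ifP => // rd <-.
  by have := step (old (rev_dart d)); rewrite E Rv /= rd rev_dartK.
have oF d : o (from_centre (phi d)) = o (from_centre d).
  by have := step (to_centre (phi d)); rewrite E Rv permK.
have oVn d d' : n d = n d' -> o (from_src d) = o (from_src d').
  move/eqP; rewrite -(node_orbit mapM) => /porbitP[i ->].
  by elim: i => [|i ->]; rewrite ?perm1 // expgSr permM oV2.
have oFp d d' : p d = p d' -> o (from_centre d) = o (from_centre d').
  move/eqP; rewrite -(face_orbit mapM) => /porbitP[i ->].
  by elim: i => [|i ->]; rewrite ?perm1 // expgSr permM oF.
(* The orbit expected at each kind of vertex, named by a standard dart leaving it; darts with equal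
   sources then have equal orbits. *)
pose canon (w : ref_node) (X : {set ref_dart}) := match w with
  | inl (inl v) => forall d, n d = v -> X = o (from_src d)
  | inl (inr d) => X = o (to_centre d)
  | inr f => forall d, p d = f -> X = o (from_centre d)
  end.
have canonP x : canon (ref_src x) (o x).
  case: (ref_dartP x) => d; rewrite S /= ?oX1 ?oX2 ?oX3 ?oX4 //.
  - by case: ifP => rd; rewrite /= oold rd // => d' /oVn.
  - by move=> d' /oVn.
  - move=> d' /oVn ->; rewrite oV1; apply: oVn.
    by rewrite phiE (node_rot mapM).
  - by move=> d' /oFp.
have canon_eq w X Y : canon w X -> canon w Y -> X = Y.
  case: w => [[v|d]|f] /= cX cY; last 1 first.
  - by have [d /[dup] /cX -> /cY ->] := face_onto mapM f.
  - by have [d /[dup] /cX -> /cY ->] := node_onto mapM v.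
  - by rewrite cX cY.
split.
- move=> x y; apply/idP/eqP => [/porbitP[i ->]|eqS].
    by elim: i => [|i ->]; rewrite ?perm1 // expgSr permM ref_src_rot.
  by apply/o_eq/(canon_eq (ref_src x)); [|rewrite eqS]; apply: canonP.
- by move=> x y; rewrite ref_rot_face orbit_ofP.
- case=> [[v|d]|f]; last 1 first.
  + by have [d <-] := face_onto mapM f; exists (from_centre d); rewrite S.
  + by have [d <-] := node_onto mapM v; exists (from_src d); rewrite S.
  + by exists (to_centre d); rewrite S.
- exact: orbit_of_onto.
move=> P Prev Prot.
have Pface x : P (ref_face_fun x) = P x.
  by rewrite -[RHS]Prev -[RHS]Prot ref_rotE rev_dartK.
have Pnext d : P (ring_next d) = P (to_centre d).
  by have := Pface (from_centre d); rewrite E => ->; rewrite -Prev Rv.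
have Ptgt d : P (from_tgt d) = P (to_centre d).
  rewrite -Pnext -[in RHS]Prev Rv -[RHS]Pface E -[RHS]Prev Rv //.
have Pold d : P (old d) = P (to_centre d).
  rewrite -Ptgt; case rd: (r d.1); last by have := Pface (old d); rewrite E rd.
  by have := Pface (from_tgt d); rewrite E rd -Rv Prev.
have Psrc d : P (to_src d) = P (to_centre d).
  rewrite -Pold; case rd: (r d.1); first by have := Pface (old d); rewrite E rd.
  by have := Pface (to_src d); rewrite E rd.
have Pphi d : P (to_centre (phi d)) = P (to_centre d).
  by rewrite -Pnext -[RHS]Pnext -[RHS]Pface E Pnext.
(* An invariant predicate takes the value at [to_centre d] on all darts named after [d], so
   connectedness is inherited from the old map. *)
have Pown x : exists d, P x = P (to_centre d).
  case: (ref_dartP x) => d; exists d; rewrite ?Pold ?Ptgt ?Psrc ?Pnext //;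
    rewrite -Prev Rv ?Ptgt ?Psrc ?Pnext //.
move=> x y; have [d ->] := Pown x; have [d' ->] := Pown y.
apply: (map_connected mapM (P := fun e => P (to_centre e))) => e.
  by rewrite -Pold -[RHS]Pold -Prev Rv rev_dartK.
by rewrite -[e in LHS]rev_dartK -phiE Pphi -Pold -[RHS]Pold -Prev Rv rev_dartK.
Qed.

Lemma card_ref_arc : #|ref_arc| = 9 * #|A|.
Proof. by rewrite card_sum !card_prod card_bool; lia. Qed.

Lemma card_ref_node : #|ref_node| = #|V| + 2 * #|A| + #|F|.
Proof. by rewrite !card_sum card_prod card_bool; lia. Qed.

Lemma card_ref_face : #|orbit_type ref_face| = 6 * #|A|.
Proof.
have := card_porbits3 ref_face3 ref_face_fix.
by rewrite card_orbit_type card_prod card_ref_arc card_bool; lia.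
Qed.

(** The counts [9 * #|A|], [#|V| + 2 * #|A| + #|F|] and [6 * #|A|] leave the Euler characteristic
    unchanged. *)
Lemma ref_euler :
  #|A| + 2 <= #|V| + #|F| -> #|ref_arc| + 2 <= #|ref_node| + #|orbit_type ref_face|.
Proof. by rewrite card_ref_arc card_ref_node card_ref_face; lia. Qed.

End Refinement.

(** * Directed cycles and duality *)

Section Dicycles.

Variable D : digraph.
Implicit Types (X : {set vert D}) (S : {set arcs D}) (c : seq (arcs D)).

(** Choose an arc of [S] out of each tail vertex; the map sending a vertex to the head of its arc
    eventually cycles. *)
Lemma dicycle_of_successors S :
  S != set0 -> (forall a, a \in S -> exists2 b, b \in S & src b = tgt a) ->
  exists2 c, dicycle c & {subset c <= S}.
Proof.
case/set0Pn => a0 a0S succ.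
pose W := [pred v | [exists a in S, src a == v]].
pose arc_at v := odflt a0 [pick a in S | src a == v].
have arc_atP v : v \in W -> arc_at v \in S /\ src (arc_at v) = v.
  rewrite /arc_at inE => /exists_inP[a aS av]; case: pickP => [b /andP[bS /eqP]//|].
  by move=> /(_ a); rewrite aS av.
pose f v := tgt (arc_at v).
have fW v : v \in W -> f v \in W.
  move=> /arc_atP[aS _]; have [b bS bv] := succ _ aS.
  by rewrite inE; apply/exists_inP; exists b => //; apply/eqP.
have iterW i v : v \in W -> iter i f v \in W by move=> vW; elim: i => // i; apply: fW.
have v0W : src a0 \in W by rewrite inE; apply/exists_inP; exists a0.
(* After as many steps as the orbit has elements a vertex is repeated, so [x] lies on the cycle of
   [f]. *)
pose k := fingraph.order f (src a0); pose x := iter k f (src a0).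
have x_conn : fconnect f (src a0) x by apply: fconnect_iter.
have lt_k := findex_max x_conn; set j := findex _ _ _ in lt_k.
have xj : iter j f (src a0) = x by apply: iter_findex.
have x_cyc : fconnect f (f x) x.
  have xE : iter (k - j.+1) f (f x) = x.
    rewrite -iterSr -xj -iterD [RHS]xj /x; congr (iter _ f _).
    by move: lt_k; rewrite -/k; lia.
  by have := fconnect_iter f (k - j.+1) (f x); rewrite xE.
have cyc : fcycle f (fingraph.orbit f x) by rewrite -fconnect_f.
have xW : x \in W by apply: iterW.
have orbW v : v \in fingraph.orbit f x -> v \in W.
  by rewrite -fconnect_orbit => /iter_findex <-; apply: iterW.
exists (map arc_at (fingraph.orbit f x)); last first.
  by move=> _ /mapP[v /orbW/arc_atP[aS _] ->].
have srcE : map (@src D) (map arc_at (fingraph.orbit f x)) = fingraph.orbit f x.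
  by rewrite -map_comp -[RHS]map_id; apply/eq_in_map => v /orbW/arc_atP[].
apply/and3P; split.
- by rewrite /fingraph.orbit /= -orderSpred.
- rewrite cycle_relE srcE -map_comp; move: cyc.
  by rewrite (@cycle_relE _ _ id f) map_id.
- by rewrite srcE fingraph.orbit_uniq.
Qed.

Lemma dicycle_constant X c :
  dicycle c -> {in c, forall a, (src a \in X) = (tgt a \in X)} ->
  all (fun a => src a \in X) c \/ all (fun a => src a \in ~: X) c.
Proof.
move=> /and3P[+ cyc _] const; case: c cyc const => // a c cyc const _.
have aX b : b \in a :: c -> (src b \in X) = (src a \in X).
  move: cyc; rewrite /path.cycle rcons_path => /andP[+ _].
  elim: c a b const => [|e c IHc] a b const /=; first by rewrite inE => _ /eqP->.
  case/andP => /eqP ae ec; rewrite inE => /orP[/eqP-> //|be].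
  rewrite (const a) ?mem_head // ae; apply: IHc be => // x xc; apply: const.
  by rewrite inE xc orbT.
have [sX|sX] := boolP (src a \in X); [left|right]; apply/allP => b /aX; rewrite ?inE => ->.
  exact: sX.
exact: sX.
Qed.

Lemma triangle_dicycle (a b c : arcs D) :
  (forall x : arcs D, src x != tgt x) ->
  tgt a = src b -> tgt b = src c -> tgt c = src a -> dicycle [:: a; b; c].
Proof.
move=> loopless ab bc ca; rewrite /dicycle /= ab bc ca !eqxx /= !inE negb_or.
have := loopless a; have := loopless b; have := loopless c.
by rewrite ab bc ca (eq_sym (src a) (src c)) => -> -> ->.
Qed.

Lemma bichromatic_triangle X (a b c : arcs D) :
  acyclic X -> acyclic (~: X) -> (forall x : arcs D, src x != tgt x) ->
  tgt a = src b -> tgt b = src c -> tgt c = src a ->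
  ~ ((src a \in X) = (src b \in X) /\ (src b \in X) = (src c \in X)).
Proof.
move=> acX acX' loopless ab bc ca [eq1 eq2].
have cyc := triangle_dicycle loopless ab bc ca.
have := acX _ cyc; have := acX' _ cyc; rewrite /= !inE eq1 eq2.
by case: (src c \in X).
Qed.

End Dicycles.

Lemma card_porbits_labels (T F : finType) (t : {perm T}) (p : T -> F) :
  (forall x y, (y \in porbit t x) = (p x == p y)) -> (forall f, exists x, p x = f) ->
  #|porbits t| = #|F|.
Proof.
move=> pP onto; pose fiber f := [set x | p x == f].
have fiberE x : fiber (p x) = porbit t x.
  by apply/setP => y; rewrite inE pP eq_sym.
rewrite -(card_imset F (f := fiber)) => [|f g fg]; last first.
  have [x xf] := onto f; have: x \in fiber f by rewrite inE xf.
  by rewrite fg inE xf => /eqP.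
apply: eq_card => X; apply/imsetP/imsetP => [[x _ ->]|[f _ ->]].
  by exists (p x); rewrite // fiberE.
by have [x <-] := onto f; exists x; rewrite // fiberE.
Qed.

Definition map_digraph (A V : finType) (n : A * bool -> V) : digraph :=
  @Digraph V A (fun a => n (a, true)) (fun a => n (a, false)).

(** Besides parallel and antiparallel arcs this excludes loops, as the two darts of a loop have the
    same ends. *)
Definition simple_map (A V : finType) (n : A * bool -> V) : Prop :=
  injective (fun d => (n d, n (rev_dart d))).

Section MapDigraph.

Variables (A V : finType) (n : A * bool -> V).

Lemma map_dsrc (d : dart (map_digraph n)) : dsrc d = n d.
Proof. by case: d => a []. Qed.

Lemma map_dtgt (d : dart (map_digraph n)) : dtgt d = n (rev_dart d).
Proof. by case: d => a []. Qed.

Lemma simple_map_loopless d : simple_map n -> n d != n (rev_dart d).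
Proof.
move=> simp; apply/eqP => eqn; have /eqP := rev_dart_neq d; apply.
by apply: simp; rewrite rev_dartK eqn.
Qed.

Lemma simple_map_oriented : simple_map n -> oriented (map_digraph n).
Proof.
move=> simp [|a [|b [|e c]]] // /and3P[_ /= + _].
  by rewrite andbT => /eqP eqn; have := simple_map_loopless (a, true) simp; rewrite eqn eqxx.
case/and3P => /eqP ab /eqP ba _.
have : (a, true) = (b, false) :> A * bool by apply: simp; rewrite /rev_dart /= ab ba.
by [].
Qed.

End MapDigraph.

Section MapPlanarity.

Variables (A V F : finType) (n : A * bool -> V) (p : A * bool -> F).
Variable s : {perm A * bool}.
Hypothesis mapM : connected_map n p s.

Lemma map_digraph_connected u v : connect (@adj (map_digraph n) setT) u v.
Proof.
have [d <-] := node_onto mapM u; have [e <-] := node_onto mapM v.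
pose P e := connect (@adj (map_digraph n) setT) (n d) (n e).
rewrite -[connect _ _ _]/(P e) -(map_connected mapM (P := P) _ _ d) => [|x|x].
- exact: connect0.
- have xx : connect (@adj (map_digraph n) setT) (n x) (n (rev_dart x)).
    by apply: connect1; apply/adjP; exists x; rewrite ?inE ?map_dsrc ?map_dtgt.
  rewrite /P; apply/idP/idP => [dx|dx]; last exact: connect_trans dx xx.
  by apply: connect_trans dx _; rewrite (@adj_connect_sym (map_digraph n)).
- by rewrite /P (node_rot mapM).
Qed.

Lemma map_cut_neq0 (X : {set V}) :
  X != set0 -> X != setT -> exists a, a \in @cut (map_digraph n) X.
Proof.
case/set0Pn => u uX; rewrite -subTset => /subsetPn[v _ vX].
by have [a _ aX] := connect_cross (map_digraph_connected u v) uX vX; exists a.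
Qed.

Hypothesis euler : #|A| + 2 <= #|V| + #|F|.

(** The map is connected, so there is one component, and [euler_le] turns the hypothesis into an
    equality. *)
Lemma map_planar : planar (map_digraph n).
Proof.
exists s => [d d'|]; first by rewrite !map_dsrc (node_orbit mapM).
have -> : #|faces (D := map_digraph n) s| = #|F|.
  rewrite /faces; set t := (_ * _)%g.
  have -> : t = (rev_perm A * s)%g by apply/permP => d; rewrite !permM !permE.
  apply: card_porbits_labels; [exact: face_orbit mapM | exact: face_onto mapM].
have -> : [set dsrc d | d : dart (map_digraph n)] = setT.
  apply/setP => v; rewrite inE; have [d <-] := node_onto mapM v.
  by rewrite -map_dsrc imset_f.
have [d _] : exists d : dart (map_digraph n), d \in predT.
  have: 0 < #|V| + #|F| by lia.
  rewrite addn_gt0 => /orP[]/card_gt0P[x _].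
    by have [d _] := node_onto mapM x; exists d.
  by have [d _] := face_onto mapM x; exists d.
have compT e : component setT (dsrc e) = [set: vert (map_digraph n)].
  by apply/setP => v; rewrite !inE map_digraph_connected.
have -> : [set component setT (dsrc e) | e : dart (map_digraph n)] = [set setT].
  apply/setP => X; rewrite inE; apply/imsetP/eqP => [[e _ ->]|->]; first exact: compT.
  by exists d; rewrite // compT.
have e2 : #|V| + #|F| = #|A| + 2 by have := euler_le mapM; lia.
by rewrite cards1 cardsT; exact: e2.
Qed.

End MapPlanarity.

Section Circulations.

Local Open Scope ring_scope.

Variables (A V F : finType) (n : A * bool -> V) (p : A * bool -> F).
Variable s : {perm A * bool}.
Hypothesis mapM : connected_map n p s.

(** Potential differences are combinations of vertex incidences, which are orthogonal to the face
    incidences. *)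
Lemma circulation_of_potential (R : fieldType) (h : V -> R) f :
  \sum_a (h (n (a, true)) - h (n (a, false))) * boundary R p a f = 0.
Proof.
under eq_bigr => a _ do rewrite -(sum_boundary n h a) mulr_suml.
rewrite exchange_big big1 // => v _.
under eq_bigr => a _ do rewrite -mulrA.
by rewrite -mulr_sumr (boundary_orthogonal mapM) mulr0.
Qed.

End Circulations.

(** A vanishing sum cannot have exactly one nonzero term. *)
Lemma second_arc (R : fieldType) (A V : finType) (n : A * bool -> V) (g : A -> R) a v :
  (\sum_b g b * boundary R n b v = 0)%R ->
  (g a != 0)%R -> (boundary R n a v != 0)%R ->
  exists b, [/\ b != a, (g b != 0)%R & (boundary R n b v != 0)%R].
Proof.
move=> sum0 ga bd; have [/existsP[b /and3P[]]|/existsPn none] :=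
  boolP [exists b, [&& b != a, g b != 0 & boundary R n b v != 0]%R]; first by exists b.
move: sum0; rewrite (bigD1 a) //= big1 ?addr0 => [/eqP|b ba].
  by rewrite mulf_eq0 (negbTE ga) (negbTE bd).
have := none b; rewrite ba /= negb_and !negbK => /orP[]/eqP->; by rewrite ?mul0r ?mulr0.
Qed.

Section DualConnectivity.

Variables (A V F : finType) (n : A * bool -> V) (p : A * bool -> F).
Variable s : {perm A * bool}.
Hypothesis mapM : connected_map n p s.
Hypothesis simp : simple_map n.

(** The differences of the indicator of [X] form a circulation at the vertices, supported on the
    cut. So each end of an arc [a] of the cut meets a further arc of the cut; a single further arc
    would join the same ends as [a], which simplicity forbids. *)
Lemma dual_cut_ge3 (X : {set F}) :
  X != set0 -> X != setT -> 3 <= #|@cut (map_digraph p) X|.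
Proof.
move=> X0 XT; have [a aX] := map_cut_neq0 (dual_map mapM) X0 XT.
rewrite leqNgt; apply/negP => lt3.
pose h f : rat := (f \in X)%:R%R.
pose g b := (h (p (b, true)) - h (p (b, false)))%R.
have gX b : (g b != 0%R) = (b \in @cut (map_digraph p) X).
  by rewrite /g /h inE /=; do 2!case: (_ \in X).
have loop b : n (b, true) != n (b, false) := simple_map_loopless (b, true) simp.
have other v : boundary rat n a v != 0%R ->
    exists b, [/\ b != a, b \in @cut (map_digraph p) X & boundary rat n b v != 0%R].
  move=> av; have sum0 := circulation_of_potential (dual_map mapM) h v.
  have [|b [ba gb bv]] := second_arc sum0 _ av; first by rewrite gX.
  by exists b; rewrite -gX.
have ends b v : boundary rat n b v != 0%R -> n (b, true) = v \/ n (b, false) = v.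
  rewrite /boundary; case: (n (b, true) =P v) => [e|_]; first by left.
  by case: (n (b, false) =P v) => [e|_]; [right | rewrite subrr eqxx].
have [|b [ba bX bu]] := other (n (a, true)).
  by rewrite /boundary eqxx [n (a, false) == _]eq_sym (negbTE (loop a)) subr0 oner_eq0.
have [|b' [b'a b'X b'v]] := other (n (a, false)).
  by rewrite /boundary eqxx (negbTE (loop a)) sub0r oppr_eq0 oner_eq0.
have eqb : b' = b.
  apply/eqP; apply: contraLR lt3 => b'b; rewrite -leqNgt; apply/card_gt2P.
  by exists a, b, b'; split=> //; split; rewrite // eq_sym.
rewrite {}eqb {b'a b'X} in b'v.
have [/ends bu' /ends bv'] := (bu, b'v).
have aa := loop a; case: bu' bv' => [e1|e1] [e2|e2].
- by rewrite -e1 -e2 eqxx in aa.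
- by have /simp[ab] : (n (b, true), n (b, false)) = (n (a, true), n (a, false));
    [rewrite e1 e2 | rewrite ab eqxx in ba].
- have : (b, false) = (a, true) by apply: simp; rewrite /rev_dart /= e1 e2.
  by [].
- by rewrite -e1 -e2 eqxx in aa.
Qed.

End DualConnectivity.

(* Stated for variables, these keep injection from splitting [rev_dart d]. *)
Lemma old_node_inj (A V F : finType) (v w : V) :
  inl (inl v) = inl (inl w) :> ref_node A V F -> v = w.
Proof. by case. Qed.

Lemma new_node_inj (A V F : finType) (d e : A * bool) :
  inl (inr d) = inl (inr e) :> ref_node A V F -> d = e.
Proof. by case. Qed.

Section RefinementSimple.

Variables (A V F : finType) (n : A * bool -> V) (p : A * bool -> F).
Variables (s : {perm A * bool}) (r : A -> bool).
Hypothesis mapM : connected_map n p s.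

Notation phi := (rev_perm A * s)%g.

Hypothesis loopless : forall d, n d != n (rev_dart d).

Lemma face_fix d : phi d != d.
Proof.
rewrite phiE; apply: contra (loopless (rev_dart d)) => /eqP eq_d.
by rewrite rev_dartK -[X in _ == n X]eq_d (node_rot mapM).
Qed.

(** Faces of length at most 2 would make ring arcs parallel or loops. An exchanged arc joins the new
    vertices beside its two darts, and would be parallel to a ring arc if [phi d = rev_dart d], that
    is, at a vertex of degree 1. The last hypothesis is simplicity of the arcs that are kept. *)
Lemma ref_simple :
  (forall d, phi (phi d) != d) ->
  (forall d, r d.1 -> phi d != rev_dart d) ->
  (forall d d', ~~ r d.1 -> ~~ r d'.1 ->
     n d = n d' -> n (rev_dart d) = n (rev_dart d') -> d = d') ->
  simple_map (ref_src n p s r).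
Proof.
move=> phi2 phir par x y.
have S := ref_src_spec n p s r; have Rv := ref_rev_spec A.
have llF d : n d = n (rev_dart d) -> False by move/eqP; rewrite (negbTE (loopless d)).
have p2F d : phi (phi d) = d -> False by move/eqP; rewrite (negbTE (phi2 d)).
have prF d : r d.1 -> phi d = rev_dart d -> False.
  by move=> rd /eqP; rewrite (negbTE (phir d rd)).
have pr' d : r d.1 -> phi (rev_dart d) = d -> False.
  by move=> rd e; apply: (prF (rev_dart d)); rewrite // rev_dartK.
have inX := @new_node_inj A V F; have inV := @old_node_inj A V F.
case: (ref_dartP x) => d; case: (ref_dartP y) => d'; rewrite !Rv !S ?rev_dartK //=;
  try (case: ifP => rd); try (case: ifP => rd') => //;
  move=> E; move: {E}(congr1 fst E) (congr1 snd E) => /= //.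
- by move=> _ /inX->.
- by move=> /inV e1 /inV e2; congr old; apply: par; rewrite ?rd ?rd'.
- by move=> /inX e1 /inX e2; case: (pr' d rd); rewrite e1.
- by move=> /inX e1 /inX e2; case: (prF d rd); rewrite e1 e2.
- by move=> _ /inX->.
- by move=> /inV e1 /inX e2; case: (llF d); rewrite e1 e2.
- by move=> /inX->.
- by move=> /inX e1 /inV e2; case: (llF d); rewrite e2 e1.
- by move=> /inV e1 /inX e2; case: (llF d); rewrite e1 e2.
- by move=> _ /inX->.
- by move=> /inX e1 /inV e2; case: (llF d); rewrite e2 e1.
- by move=> /inX->.
- by move=> /inX e1 /inX e2; case: (pr' d' rd); rewrite -e1.
- by move=> /inX->.
- by move=> /inX e1 /inX e2; case: (p2F d); rewrite e2 -e1.
- by move=> /inX e1 /inX e2; case: (prF d' rd); rewrite -e1 e2.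
- by move=> /inX e1 /inX e2; case: (p2F d); rewrite e1 -e2.
- by move=> _ /inX->.
- by move=> /inX->.
- by move=> _ /inX->.
Qed.

End RefinementSimple.

(** * From bipartitions to perfect matchings *)

Lemma connected_map_of_digraph (A V : finType) (n : A * bool -> V) s :
  (forall d d', (d' \in porbit s d) = (n d == n d')) ->
  (forall v, exists d, n d = v) ->
  (forall u v, connect (@adj (map_digraph n) setT) u v) ->
  connected_map n (orbit_of (rev_perm A * s)%g) s.
Proof.
move=> nP onto conn; split=> //; [exact: orbit_ofP | exact: orbit_of_onto | ].
move=> P Prev Ps d d'.
have Pn e e' : n e = n e' -> P e = P e'.
  move/eqP; rewrite -nP => /porbitP[i ->].
  by elim: i => [|i ->]; rewrite ?perm1 // expgSr permM Ps.
pose Q w := [forall e, (n e == w) ==> (P e == P d)].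
have QE e : Q (n e) = (P e == P d).
  apply/forallP/idP => [/(_ e)|Pe e']; first by rewrite eqxx.
  by apply/implyP => /eqP/Pn ->.
have : Q (n d').
  apply: (connect_invariant (P := Q)) (conn (n d) (n d')) _; last by rewrite QE.
  by move=> x y /adjP[e _ []]; rewrite map_dsrc map_dtgt => <- <-; rewrite !QE Prev.
by rewrite QE => /eqP.
Qed.

(** Equal booleans mean that the darts all follow or all oppose their arcs; in the second case the
    directed triangle runs in the order [a], [e], [b]. *)
Lemma dart_triangle (A V : finType) (n : A * bool -> V) (X : {set V}) x y z :
  simple_map n ->
  @acyclic (map_digraph n) X -> @acyclic (map_digraph n) (~: X) ->
  x.2 = y.2 -> y.2 = z.2 ->
  n (rev_dart x) = n y -> n (rev_dart y) = n z -> n (rev_dart z) = n x ->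
  ~ ((n x \in X) = (n y \in X) /\ (n y \in X) = (n z \in X)).
Proof.
move=> simp acX acX'; have loopless (a : arcs (map_digraph n)) : src a != tgt a.
  exact: simple_map_loopless (a, true) simp.
case: x y z => [a c] [b c'] [e c''] /= <- <-; rewrite /rev_dart /=.
case: c {c' c''} => /= ab be ea; first exact: (@bichromatic_triangle (map_digraph n) X a b e).
move=> [e1 e2]; apply: (@bichromatic_triangle (map_digraph n) X a e b) => //=.
by rewrite ab be ea; split; rewrite ?e1 ?e2.
Qed.

Section DualSimple.

Local Open Scope ring_scope.

Variables (A V F : finType) (n : A * bool -> V) (p : A * bool -> F).
Variable s : {perm A * bool}.
Hypothesis mapM : connected_map n p s.
Hypothesis euler : (#|A| + 2 <= #|V| + #|F|)%N.
Hypothesis cut3 : forall X : {set V}, X != set0 -> X != setT ->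
  (3 <= #|@cut (map_digraph n) X|)%N.

(** An upper level set of [h] separates the ends of [a], and an arc crossing it joins different
    levels. *)
Lemma level_cut (g : A -> rat) (h : V -> rat) a :
  (forall b, g b = h (n (b, true)) - h (n (b, false))) -> g a != 0 ->
  exists X : {set V}, [/\ X != set0, X != setT
    & @cut (map_digraph n) X \subset [set b | g b != 0]].
Proof.
move=> gh ga; pose m := Num.min (h (n (a, true))) (h (n (a, false))).
exists [set v | m < h v]; rewrite -subTset; split.
- case: (ltgtP (h (n (a, true))) (h (n (a, false)))) => [lt|lt|eq_h].
  + by apply/set0Pn; exists (n (a, false)); rewrite inE /m (min_idPl _) ?ltW.
  + by apply/set0Pn; exists (n (a, true)); rewrite inE /m (min_idPr _) ?ltW.
  + by rewrite gh eq_h subrr eqxx in ga.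
- apply/subsetPn; rewrite /m; case: leP => _.
    by exists (n (a, true)); rewrite ?inE // ltxx.
  by exists (n (a, false)); rewrite ?inE // ltxx.
- apply/subsetP => b; rewrite !inE gh subr_eq0 /=; apply: contra => /eqP->.
  by rewrite eqxx.
Qed.

(** If two darts of the dual have the same ends, the difference of the unit flows along them is a
    circulation of the dual, hence a potential difference on the vertices, and a level set gives a
    cut of at most two arcs. *)
Lemma dual_simple : simple_map p.
Proof.
move=> d d' [eq_p eq_p']; apply/eqP/negPn/negP => dd'.
pose sgn (e : A * bool) a : rat := if e.1 == a then (-1) ^+ (~~ e.2) else 0.
have sgn_boundary e f : \sum_a sgn e a * boundary rat p a f =
    (p e == f)%:R - (p (rev_dart e) == f)%:R.
  rewrite (bigD1 e.1) //= big1 ?addr0 => [|a ae]; last first.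
    by rewrite /sgn eq_sym (negbTE ae) mul0r.
  rewrite /sgn eqxx /boundary; case: e => a []; rewrite /rev_dart /=.
    by rewrite mul1r.
  by rewrite expr1 mulN1r opprB.
pose g a := sgn d a - sgn d' a.
have [|h gh] := potential_of_circulation (g := g) mapM euler.
  move=> f; under eq_bigr => a _ do rewrite mulrBl.
  by rewrite big_split /= sumrN !sgn_boundary eq_p eq_p' subrr.
have gd : g d.1 != 0.
  (* Distinct darts on the same arc are opposite, and the coefficient is then 2 or -2. *)
  rewrite /g /sgn eqxx; case: (d'.1 =P d.1) => [dd1|_]; last by rewrite subr0 signr_eq0.
  have -> : d'.2 = ~~ d.2.
    by case: d d' dd1 dd' {eq_p eq_p' g gh} => a b [a' b'] /= ->; case: b; case: b'; rewrite ?eqxx.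
  by case: d.2.
have [X [X0 XT sub]] := level_cut gh gd.
have : (#|@cut (map_digraph n) X| <= #|[set d.1; d'.1]|)%N.
  apply/subset_leq_card/(subset_trans sub)/subsetP => a; rewrite !inE.
  apply: contraR; rewrite negb_or => /andP[ad ad'].
  by rewrite /g /sgn ![_.1 == a]eq_sym (negbTE ad) (negbTE ad') subrr.
by have := cut3 X0 XT; rewrite cards2; case: (_ != _) => /= ? ?; lia.
Qed.

End DualSimple.

Section CubicMap.

Variables (A V F : finType) (n : A * bool -> V) (p : A * bool -> F).
Variable s : {perm A * bool}.
Hypothesis mapM : connected_map n p s.
Hypothesis euler : #|A| + 2 <= #|V| + #|F|.
Hypothesis cut3 : forall X : {set V}, X != set0 -> X != setT ->
  3 <= #|@cut (map_digraph n) X|.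
Hypothesis cub : forall d, #|porbit s d| = 3.

Lemma rot3 d : s (s (s d)) = d.
Proof. by have := iter_porbit s d; rewrite cub. Qed.

Lemma rot_uniq d : uniq [:: d; s d; s (s d)].
Proof. by have := uniq_traject_porbit s d; rewrite cub. Qed.

(** The oriented graph to be coloured is the refined dual, whose old vertices are the faces of the
    cubic map; the arcs between equally coloured faces form the matching. *)
Lemma cubic_map_matching :
  (forall D : digraph, oriented D -> planar D ->
      exists X : {set vert D}, acyclic X /\ acyclic (~: X)) ->
  exists M : {set arcs (map_digraph n)},
    perfect_matching M /\ ~ contains_directed_cut M.
Proof.
move=> colour; have simp := dual_simple mapM euler cut3.
have mapD := dual_map mapM; set t := (_ * _)%g in mapD.
have phiE d : (rev_perm A * t)%g d = s d.
  by rewrite !permM !rev_permE rev_dartK.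
pose R := ref_src p n t (fun=> false).
have simpR : simple_map R.
  apply: ref_simple => //.
  - by move=> d; apply: simple_map_loopless.
  - move=> d; rewrite !phiE; have := rot_uniq d; rewrite /= !inE negb_or.
    by case/andP => /andP[_]; rewrite eq_sym.
  - by move=> d d' _ _ e1 e2; apply: simp; rewrite e1 e2.
have mapR := ref_map (fun=> false) mapD.
have eulerD : #|A| + 2 <= #|F| + #|V| by rewrite [#|F| + _]addnC.
have [||X [acX acX']] := colour (map_digraph R).
- exact: simple_map_oriented.
- by apply: map_planar mapR _; apply: ref_euler.
pose c d := inl (inl (p d)) \in X.
pose cx d := inl (inr d) \in X.
have E := ref_src_spec p n t (fun=> false); have Rv := ref_rev_spec A.
have tri d : ~~ ((c d == c (rev_dart d)) && (c (rev_dart d) == cx d)).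
  apply/negP => /andP[/eqP e1 /eqP e2].
  apply: (@dart_triangle _ _ R X (old d) (from_tgt d) (to_src d) simpR acX acX');
    by rewrite ?Rv /R ?E.
have ring d : ~~ ((cx d == cx (s d)) && (cx (s d) == cx (s (s d)))).
  apply/negP => /andP[/eqP e1 /eqP e2].
  apply: (@dart_triangle _ _ R X (ring_next d) (ring_next (s d)) (ring_next (s (s d)))
    simpR acX acX'); by rewrite ?Rv /R ?E ?phiE ?rot3.
have crev d : c (rev_dart d) = c (s d) by rewrite /c (face_rot mapM).
(* If the three faces at a vertex had one colour, the triangles over the sides would give all three
   ring vertices the other colour, and the directed ring would be monochromatic. *)
have rainbow d : ~~ ((c d == c (s d)) && (c (s d) == c (s (s d)))).
  apply/negP => /andP[/eqP e1 /eqP e2]; move: (ring d) (tri d) (tri (s d)) (tri (s (s d))).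
  rewrite !crev rot3 -e2 -e1 eqxx /=.
  by case: (c d); case: (cx d); case: (cx (s d)); case: (cx (s (s d))).
(* Of three faces in two colours, not all equal, exactly one pair agrees, whence degree 1 at each
   vertex. *)
pose M : {set arcs (map_digraph n)} := [set a | c (a, true) == c (a, false)].
have inM d : (d.1 \in M) = (c d == c (s d)).
  by rewrite -crev inE; case: d => a []; rewrite /rev_dart //= eq_sym.
exists M; split.
  move=> v; have [d dv] := node_onto mapM v.
  rewrite degree_darts; set S := [set e | _].
  have -> : #|S| = count [in S] [:: d; s d; s (s d)].
    rewrite -size_filter -(card_uniqP (filter_uniq _ (rot_uniq d))).
    apply: eq_card => e; rewrite mem_filter andb_idr //.
    rewrite /S inE map_dsrc -dv eq_sym -(node_orbit mapM) => /andP[_].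
    by rewrite porbit_traject cub.
  have inS e : n e = v -> (e \in S) = (c e == c (s e)).
    by move=> ev; rewrite /S inE map_dsrc ev eqxx andbT inM.
  rewrite /= !inS ?(node_rot mapM) // rot3 addn0.
  by have := rainbow d; case: (c d); case: (c (s d)); case: (c (s (s d))).
case=> C [[Y [Y0 YT CY Cdir]] CM].
have [a0 a0Y] := map_cut_neq0 mapM Y0 YT.
(* In the dual, the arcs of a directed cut have successors among themselves, hence contain a
   directed cycle; lying over [M], its arcs have equally coloured ends, so the cycle is
   monochromatic. *)
pose C' : {set arcs (map_digraph R)} := [set inl a | a in C].
have CE a : (a \in C) = (n (a, true) \in Y) && (n (a, false) \notin Y).
  apply/idP/andP => [aC|[sY tY]]; last by rewrite CY inE /= sY (negbTE tY).
  have := Cdir _ aC; have := aC; rewrite CY inE /= => + sY; rewrite sY.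
  by case: (_ \in Y).
have CY' a : (a \notin C) = ((n (a, true) \in Y) == (n (a, false) \in Y)).
  by rewrite CY inE negbK.
have [||w dw wC] := @dicycle_of_successors (map_digraph R) C'.
- by apply/set0Pn; exists (inl a0); rewrite imset_f // CY.
- move=> _ /imsetP[a aC ->]; pose f := p (a, false).
  suff [b bC bf] : exists2 b, b \in C & p (b, true) = f.
    exists (inl b); first exact: imset_f.
    by rewrite /= -[RHS](E.1.1.1.1.1.1.1.1 (a, false)) /= /R /ref_src /= bf.
  (* The differences of [h] are 1 on [C] and 0 elsewhere, because the cut is directed. They sum to
     zero around [f], where [a] contributes -1 unless it is a loop of the dual, so some arc of [C]
     contributes 1. *)
  pose h v : rat := (v \in Y)%:R%R.
  have hC b : (h (n (b, true)) - h (n (b, false)) = (b \in C)%:R)%R.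
    case bC: (b \in C).
      by move: bC; rewrite CE /h => /andP[-> /negbTE->]; rewrite subr0.
    by move/negbT: bC; rewrite CY' /h => /eqP->; rewrite subrr.
  have sum0 := circulation_of_potential mapM h f.
  have [pa|pa] := eqVneq (p (a, true)) f; first by exists a.
  have bd : boundary rat p a f = (-1)%R.
    by rewrite /boundary (negbTE pa) eqxx sub0r.
  have [/existsP[b /andP[bC /eqP bf]]|/existsPn none] :=
    boolP [exists b, (b \in C) && (p (b, true) == f)]; first by exists b.
  have : (\sum_b (h (n (b, true)) - h (n (b, false))) * boundary rat p b f < 0)%R.
    rewrite (bigD1 a) //= hC aC mul1r bd ltr_wnDr //.
    apply: sumr_le0 => b _; rewrite hC; have := none b; case: (b \in C) => //= bf.
      by rewrite mul1r /boundary (negbTE bf) sub0r oppr_le0 ler0n.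
    by rewrite mul0r.
  by rewrite sum0 ltxx.
have const : {in w, forall b : arcs (map_digraph R), (src b \in X) = (tgt b \in X)}.
  move=> _ /wC/imsetP[a /(subsetP CM) + ->]; rewrite inE => /eqP.
  exact.
have [wX|wX] := dicycle_constant dw const.
  by have := acX _ dw; rewrite wX.
by have := acX' _ dw; rewrite wX.
Qed.

End CubicMap.

Lemma flip_perm (D : digraph) : perm (@flip_inj D) = rev_perm (arcs D).
Proof. by apply/permP => d; rewrite !permE. Qed.

Lemma planar_matching :
  (forall D : digraph, oriented D -> planar D ->
      exists X : {set vert D}, acyclic X /\ acyclic (~: X)) ->
  forall D : digraph, k_connected D 3 -> cubic D -> planar D ->
    exists M : {set arcs D}, perfect_matching M /\ ~ contains_directed_cut M.
Proof.
move=> colour D conn cub [s rot_s euler].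
have cut3 (X : {set vert D}) : X != set0 -> X != setT -> 3 <= #|cut X|.
  exact: k_connected_cut conn.
have onto v : exists d : dart D, dsrc d = v.
  have := cub v; rewrite degree_darts.
  case: (set_0Vmem [set d : dart D | (d.1 \in setT) && (dsrc d == v)]) => [->|[d]].
    by rewrite cards0.
  by rewrite !inE => /eqP dv _; exists d.
have connD (u v : vert D) : connect (adj setT) u v.
  case: conn => _ /(_ set0); rewrite cards0 => /(_ isT u v); rewrite !inE => /(_ isT isT).
  by apply: connect_sub => x y /and3P[_ _ xy]; apply: connect1.
have {}euler : #|vert D| + #|faces s| = #|arcs D| + 2.
  have [v _] : exists v : vert D, v \in predT.
    by apply/card_gt0P; case: conn => gt3 _; apply: leq_trans gt3.
  have [d _] := onto v.
  have compT e : component setT (dsrc e) = [set: vert D].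
    by apply/setP => w; rewrite !inE connD.
  have compsT : [set component setT (dsrc e) | e : dart D] = [set setT].
    apply/setP => X; rewrite inE; apply/imsetP/eqP => [[e _ ->]|->]; first exact: compT.
    by exists d; rewrite // compT.
  have dsrcT : [set dsrc e | e : dart D] = setT.
    by apply/setP => w; rewrite inE; have [e <-] := onto w; rewrite imset_f.
  by move: euler; rewrite compsT dsrcT cards1 cardsT muln1.
(* With [D] destructed, [map_digraph n] is convertible to it. *)
case: D conn cub s rot_s euler cut3 onto connD => V A sr tg conn cub s rot_s euler cut3 onto connD.
pose n := @dsrc (Digraph sr tg).
have mapM : connected_map n (orbit_of (rev_perm A * s)%g) s.
  exact: connected_map_of_digraph.
apply: (cubic_map_matching mapM _ cut3 _ colour).
  by rewrite card_orbit_type; move: euler; rewrite /faces flip_perm => /esym/eq_leq.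
move=> d; rewrite -(cub (n d)) degree_darts; apply: eq_card => e.
by rewrite rot_s !inE /= eq_sym.
Qed.

(** * Bipartitions from matchings of the dual *)

Section DualMatching.

Variables (A V F : finType) (n : A * bool -> V) (p : A * bool -> F).
Variable s : {perm A * bool}.
Hypothesis mapM : connected_map n p s.
Hypothesis euler : #|A| + 2 <= #|V| + #|F|.

(** The complement of [M] has degree 2 at each face, so its indicator is a circulation modulo 2 and
    comes from a two-valued potential: the arcs of [M] are those with equally coloured ends. A
    monochromatic directed cycle lies in [M]; as a rational circulation at the vertices it is a
    potential difference on the faces. *)
Lemma dual_matching_colouring (M : {set A}) :
  cubic (map_digraph p) -> @perfect_matching (map_digraph p) M ->
  ~ @contains_directed_cut (map_digraph p) M ->
  exists X : {set V}, @acyclic (map_digraph n) X /\ @acyclic (map_digraph n) (~: X).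
Proof.
move=> cub perfM noCut.
have mapD := dual_map mapM.
have eulerD : #|A| + 2 <= #|F| + #|V| by rewrite [#|F| + _]addnC.
pose g a : 'F_2 := (a \notin M)%:R%R.
have [|h gh] := potential_of_circulation (g := g) mapM euler.
  move=> f; have := @degree_setC (map_digraph p) M f; rewrite perfM cub add1n => -[deg2].
  have : ((degree (D := map_digraph p) (~: M) f)%:R = 0 :> 'F_2)%R.
    by rewrite deg2; apply/val_inj.
  rewrite degree_sum natr_sum => deg0; rewrite -[RHS]deg0 [RHS]big_mkcond.
  apply: eq_bigr => a _.
  rewrite /g /boundary !inE natrD -[X in (_ * (_ - X))%R](opprK).
  have -> : (- (p (a, false) == f)%:R = (p (a, false) == f)%:R :> 'F_2)%R.
    by case: (_ == _); apply/val_inj.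
  by rewrite opprK; case: (a \in M); rewrite ?mul0r ?mul1r.
pose X := [set v | h v == 0%R].
have inX a : (a \in M) = ((n (a, true) \in X) == (n (a, false) \in X)).
  have := gh a; rewrite /g !inE.
  have F2 (x : 'F_2) : x = 0%R \/ x = 1%R by case: x => -[|[|//]] ?; [left|right]; apply/val_inj.
  by case: (F2 (h (n (a, true)))) => ->; case: (F2 (h (n (a, false)))) => ->;
    case: (a \in M).
have mono c : @dicycle (map_digraph n) c -> {subset c <= M} -> False.
  move=> dc cM; have /and3P[c0 cyc /map_uniq uniq_c] := dc.
  pose g' a : rat := (a \in c)%:R%R.
  have [|h' gh'] := potential_of_circulation (g := g') mapD eulerD.
    move=> v; under eq_bigr => a _ do rewrite mulr_natl mulrb.
    rewrite -big_mkcond -big_uniq // /boundary big_split /= sumrN -!natr_sum.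
    by rewrite -(cycle_counts v cyc) subrr.
  case: c c0 dc cM cyc uniq_c @g' gh' => // a0 c _ dc cM cyc uniq_c g' gh'.
  (* The potential drops by 1 along the arcs of the cycle and is constant along all others, so every
     arc crossing [Y] is on the cycle and leaves [Y]. *)
  apply: noCut; pose Y := [set f | (h' (p (a0, false)) < h' f)%R].
  have step b : (h' (p (b, true)) = h' (p (b, false)) + (b \in a0 :: c)%:R)%R.
    by rewrite addrC -[X in (X + _)%R]/(g' b) gh' subrK.
  have inY b : b \in @cut (map_digraph p) Y -> b \in a0 :: c /\ p (b, true) \in Y.
    rewrite !inE /= step; case: (boolP (b \in a0 :: c)) => bc; last by rewrite addr0 eqxx.
    move=> bY; split=> //; apply: contraTT bY; rewrite negbK => bY.
    rewrite (negbTE bY) eq_sym eqbF_neg; apply: contra bY => /lt_trans; apply.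
    by rewrite ltrDl ltr01.
  exists (@cut (map_digraph p) Y); split; last by apply/subsetP => b /inY[/cM].
  exists Y; split=> //; last by move=> b /inY[].
    apply/set0Pn; exists (p (a0, true)); rewrite inE step mem_head.
    by rewrite ltrDl ltr01.
  by rewrite -subTset; apply/subsetPn; exists (p (a0, false)); rewrite ?inE // ltxx.
have tgtS (S : {set V}) c : @dicycle (map_digraph n) c ->
    all (fun a => n (a, true) \in S) c -> {in c, forall a, n (a, false) \in S}.
  move=> /and3P[_ + _] /allP sS a ac; rewrite cycle_relE => /eqP eq_c.
  have : n (a, false) \in map (@tgt (map_digraph n)) c by apply: map_f ac.
  by rewrite eq_c mem_rot => /mapP[b bc ->]; apply: sS.
exists X; split=> c dc; apply/negP => cX; apply: (mono c dc) => a ac.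
  by rewrite inX (tgtS X c) // (allP cX).
have := tgtS _ _ dc cX a ac; have := allP cX a ac; rewrite /= inX ![_ \in ~: X]inE.
by move=> /negbTE-> /negbTE->.
Qed.

End DualMatching.

(** * From perfect matchings to bipartitions *)

Lemma dicycle_map (D D' : digraph) (f : arcs D -> arcs D') (g : vert D -> vert D') c :
  injective g -> (forall a, src (f a) = g (src a)) -> (forall a, tgt (f a) = g (tgt a)) ->
  dicycle (map f c) = dicycle c.
Proof.
move=> g_inj srcf tgtf; rewrite /dicycle -!size_eq0 size_map !cycle_relE -!map_comp.
have -> : map (@src D' \o f) c = map g (map (@src D) c).
  by rewrite -map_comp; apply: eq_map => a /=; rewrite srcf.
have -> : map (@tgt D' \o f) c = map g (map (@tgt D) c).
  by rewrite -map_comp; apply: eq_map => a /=; rewrite tgtf.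
rewrite -(map_rot _ g) (map_inj_uniq g_inj); congr [&& _, _ & _].
by apply/eqP/eqP => [|-> //]; apply: inj_map.
Qed.

Section OrientedMap.

Variables (A V F : finType) (n : A * bool -> V) (p : A * bool -> F).
Variable s : {perm A * bool}.
Hypothesis mapM : connected_map n p s.
Hypothesis euler : #|A| + 2 <= #|V| + #|F|.
Hypothesis orientedM : oriented (map_digraph n).

Lemma oriented_loopless (a : A) : n (a, true) != n (a, false).
Proof.
apply/eqP => loop; suff /orientedM : @dicycle (map_digraph n) [:: a] by [].
by rewrite /dicycle /= loop eqxx.
Qed.

Lemma oriented_antiparallel (a b : A) :
  n (a, true) = n (b, false) -> n (a, false) = n (b, true) -> False.
Proof.
move=> ab ba; suff /orientedM : @dicycle (map_digraph n) [:: a; b] by [].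
rewrite /dicycle /= ab ba !eqxx !inE /=.
by have := oriented_loopless b; rewrite eq_sym => ->.
Qed.

(** The first refinement makes all faces triangles and leaves no vertex of degree 1, so that the
    second one can exchange arcs within the conditions of [ref_simple]. *)
Let no_exchange (_ : A) := false.
Let n1 := ref_src n p s no_exchange.
Let s1 := ref_rot s no_exchange.
Let p1 := ref_face_of s no_exchange.

Let map1 : connected_map n1 p1 s1 := ref_map no_exchange mapM.

Let loopless d : n d != n (rev_dart d).
Proof. by case: d => a []; rewrite /rev_dart /= ?oriented_loopless // eq_sym oriented_loopless. Qed.

Let loopless1 x : n1 x != n1 (rev_dart x).
Proof.
have S := ref_src_spec n p s no_exchange; have Rv := ref_rev_spec A.
rewrite /n1; case: (ref_dartP x) => d; rewrite Rv !S //=.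
- by apply: contra (loopless d) => /eqP/old_node_inj->.
- by apply: contra (face_fix mapM loopless d) => /eqP/new_node_inj<-.
- by apply: contra (face_fix mapM loopless d) => /eqP/new_node_inj->.
Qed.

Let phi1 : (rev_perm (ref_arc A) * s1)%g = ref_face s no_exchange.
Proof. exact: ref_rot_face. Qed.

Let phi1_rev x : ref_face s no_exchange x != rev_dart x.
Proof.
have E := ref_face_fun_spec s no_exchange; have Rv := ref_rev_spec A.
rewrite ref_faceE; case: (ref_dartP x) => d; rewrite Rv E //; apply/eqP; try by case.
have from_centre_inj e : from_centre e = from_centre d -> e = d by case.
move/from_centre_inj => eq_d; have := face_fix mapM loopless d.
by rewrite -{1}eq_d permKV eqxx.
Qed.

Let parallel (x y : ref_arc A) :=
  ((n1 (x, true) == n1 (y, true)) && (n1 (x, false) == n1 (y, false))) ||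
  ((n1 (x, true) == n1 (y, false)) && (n1 (x, false) == n1 (y, true))).

(** All members of a parallel class define the same predicate, so they pick the same
    representative. *)
Let rep (x : ref_arc A) := odflt x [pick y | parallel x y].

Let parallel_rep x : parallel x (rep x).
Proof.
by rewrite /rep; case: pickP => //= /(_ x); rewrite /parallel !eqxx.
Qed.

Let rep_eq x y : parallel x y -> rep x = rep y.
Proof.
move=> xy; have par : parallel x =1 parallel y.
  move=> z; move: xy; rewrite /parallel.
  case/orP => /andP[/eqP-> /eqP->] //.
  by rewrite orbC; congr (_ || _); rewrite andbC.
rewrite /rep (eq_pick par); case: pickP => //= /(_ y).
by rewrite /parallel !eqxx.
Qed.

Let exchange x := x != rep x.
Let n2 := ref_src n1 p1 s1 exchange.
Let p2 := ref_face_of s1 exchange.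
Let map2 : connected_map n2 p2 (ref_rot s1 exchange) := ref_map exchange map1.

Let simple2 : simple_map n2.
Proof.
apply: ref_simple => // [x|x _|x y].
- by rewrite phi1 -(inj_eq (@perm_inj _ (ref_face s no_exchange))) ref_face3 eq_sym ref_face_fix.
- by rewrite phi1 phi1_rev.
rewrite /exchange !negbK => /eqP xr /eqP yr n_xy n_xy'.
have par : parallel x.1 y.1.
  case: x y n_xy n_xy' {xr yr} => [a b] [a' b']; rewrite /parallel /rev_dart /= .
  by case: b; case: b' => /= -> ->; rewrite !eqxx ?orbT.
have eq_a : x.1 = y.1 by rewrite xr yr; apply: rep_eq.
have := loopless1 x; case: x y eq_a n_xy {par xr yr n_xy'} => [a b] [a' b'] /= -> ->.
by rewrite /rev_dart /=; case: b; case: b'; rewrite ?eqxx.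
Qed.

(** The representative of an old arc is old, since every new arc has a new vertex as an end, and has
    the same direction, since antiparallel arcs would form a directed cycle of length 2. *)
Let rep_old a b : n1 (rep (inl a), b) = inl (inl (n (a, b))).
Proof.
have n1_old c : n1 (inl a, c) = inl (inl (n (a, c))) by [].
have := parallel_rep (inl a); rewrite /parallel !n1_old.
case/orP => /andP[/eqP e1 /eqP e2]; first by case: b.
case Er: (rep _) e1 e2 => [a'|[[a' c] [[] []]]] /=; rewrite /n1 /ref_src /=.
- move/old_node_inj => e1 /old_node_inj e2.
  by case: (oriented_antiparallel e1 e2).
all: by case: c {Er}.
Qed.

(** The dual of the twice refined map is cubic because all faces are triangles, and 3-connected
    because the refined map is simple. The bipartition found there is restricted to [V]. *)
Lemma oriented_map_colouring :
  (forall D : digraph, k_connected D 3 -> cubic D -> planar D ->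
     exists M : {set arcs D}, perfect_matching M /\ ~ contains_directed_cut M) ->
  exists X : {set V}, @acyclic (map_digraph n) X /\ @acyclic (map_digraph n) (~: X).
Proof.
move=> matching.
have euler2 := ref_euler s1 exchange (ref_euler s no_exchange euler).
have euler2' : #|ref_arc (ref_arc A)| + 2 <= #|orbit_type (ref_face s1 exchange)| +
    #|ref_node (ref_arc A) (ref_node A V F) (orbit_type (ref_face s no_exchange))|.
  by rewrite [#|orbit_type (ref_face s1 exchange)| + _]addnC.
have mapD := dual_map map2.
have cub : cubic (map_digraph p2).
  move=> f; have [x xf] := face_onto map2 f.
  rewrite -(card_porbit3 (ref_face3 s1 exchange) (ref_face_fix s1 exchange) x) degree_darts.
  by apply: eq_card => y; rewrite orbit_ofP !inE /= map_dsrc -/p2 -xf eq_sym.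
have gtA : 0 < #|A|.
  have: 0 < #|V| + #|F| by lia.
  rewrite addn_gt0 => /orP[]/card_gt0P[x _]; apply/card_gt0P.
    by have [d _] := node_onto mapM x; exists d.1.
  by have [d _] := face_onto mapM x; exists d.1.
have [|||M [perfM noCut]] := matching (map_digraph p2).
- apply: cubic_k_connected => //; first exact: dual_cut_ge3 map2 simple2.
  by change (3 < #|orbit_type (ref_face s1 exchange)|); rewrite card_ref_face card_ref_arc; lia.
- by [].
- exact: map_planar mapD euler2'.
have [X2 [ac ac']] := dual_matching_colouring map2 euler2 cub perfM noCut.
pose g (v : V) : ref_node (ref_arc A) (ref_node A V F) (orbit_type (ref_face s no_exchange)) :=
  inl (inl (inl (inl v))).
(* An arc may have been exchanged away, but its representative is kept and has the same ends, so
   directed cycles survive. *)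
pose f (a : A) : ref_arc (ref_arc A) := inl (rep (inl a)).
have n2f a b : n2 (f a, b) = g (n (a, b)).
  have unexchanged : exchange (rep (inl a)) = false.
    by apply/negbTE; rewrite negbK; apply/eqP/rep_eq/parallel_rep.
  by rewrite /n2 /ref_src /= unexchanged rep_old.
have dicycle_f c : @dicycle (map_digraph n) c -> @dicycle (map_digraph n2) (map f c).
  rewrite (@dicycle_map (map_digraph n) (map_digraph n2) f g) // => [v w []|a|a] //;
    exact: n2f.
exists [set v | g v \in X2]; split=> c /dicycle_f dc; [have := ac _ dc | have := ac' _ dc];
  rewrite all_map; congr (~~ _); apply: eq_all => a /=; rewrite !inE;
  by rewrite /src /= n2f.
Qed.

End OrientedMap.

(** * Restriction of a rotation system to one component *)

Section Component.

Variables (D : digraph) (s : {perm dart D}).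
Hypothesis rot_s : rotation_system s.
Variable d0 : dart D.

Let K := component setT (dsrc d0).

Lemma component_dart (d : dart D) : (dtgt d \in K) = (dsrc d \in K).
Proof.
have st : adj setT (dsrc d) (dtgt d) by apply/adjP; exists d; rewrite ?inE.
by rewrite !inE (same_connect_r (adj_connect_sym setT) (connect1 st)).
Qed.

Lemma component_src (d : dart D) : (src d.1 \in K) = (dsrc d \in K).
Proof. by case: d => a []; rewrite //= -[RHS]component_dart. Qed.

Definition comp_arc : finType := {a : arcs D | src a \in K}.
Definition comp_vert : finType := {v : vert D | v \in K}.

Definition comp_dart (d : comp_arc * bool) : dart D := (val d.1, d.2).

Lemma comp_dart_inj : injective comp_dart.
Proof. by move=> [a b] [a' b'] [] /val_inj -> ->. Qed.

Lemma comp_dart_src d : dsrc (comp_dart d) \in K.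
Proof. by rewrite -component_src (valP d.1). Qed.

Lemma comp_dart_onto (d : dart D) : dsrc d \in K -> exists e, comp_dart e = d.
Proof. by rewrite -component_src => dK; exists (Sub d.1 dK, d.2); case: d dK. Qed.

Definition comp_src (d : comp_arc * bool) : comp_vert := Sub (dsrc (comp_dart d)) (comp_dart_src d).

Lemma comp_rot_subproof d : src (s (comp_dart d)).1 \in K.
Proof. by rewrite component_src (dsrc_rot rot_s) comp_dart_src. Qed.

Definition comp_rot_fun (d : comp_arc * bool) : comp_arc * bool :=
  (Sub (s (comp_dart d)).1 (comp_rot_subproof d), (s (comp_dart d)).2).

Lemma comp_rot_funE d : comp_dart (comp_rot_fun d) = s (comp_dart d).
Proof. by rewrite /comp_dart /=; case: (s _). Qed.

Lemma comp_rot_inj : injective comp_rot_fun.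
Proof.
move=> d e /(congr1 comp_dart); rewrite !comp_rot_funE => /perm_inj.
exact: comp_dart_inj.
Qed.

Definition comp_rot : {perm comp_arc * bool} := perm comp_rot_inj.

Lemma comp_rotE d : comp_dart (comp_rot d) = s (comp_dart d).
Proof. by rewrite permE comp_rot_funE. Qed.

Lemma comp_rot_orbit d e : (e \in porbit comp_rot d) = (comp_dart e \in porbit s (comp_dart d)).
Proof.
have expE i : comp_dart ((comp_rot ^+ i)%g d) = (s ^+ i)%g (comp_dart d).
  by elim: i => [|i IHi]; rewrite ?perm1 // !expgSr !permM comp_rotE IHi.
apply/porbitP/porbitP => [[i ->]|[i]]; exists i; first exact: expE.
by apply: comp_dart_inj; rewrite expE.
Qed.

Let t := (rev_perm (arcs D) * s)%g.
Let comp_t := (rev_perm comp_arc * comp_rot)%g.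

Lemma comp_face_orbit d e : (e \in porbit comp_t d) = (comp_dart e \in porbit t (comp_dart d)).
Proof.
have tE e' : comp_dart (comp_t e') = t (comp_dart e').
  by rewrite !permM !rev_permE comp_rotE.
have expE i : comp_dart ((comp_t ^+ i)%g d) = (t ^+ i)%g (comp_dart d).
  by elim: i => [|i IHi]; rewrite ?perm1 // !expgSr (permM (comp_t ^+ i)) (permM (t ^+ i)) tE IHi.
apply/porbitP/porbitP => [[i ->]|[i]]; exists i; first exact: expE.
by apply: comp_dart_inj; rewrite expE.
Qed.

Lemma comp_map : connected_map comp_src (orbit_of comp_t) comp_rot.
Proof.
have [e0 e0d] : exists e, comp_dart e = d0 by apply: comp_dart_onto; rewrite inE connect0.
pose conn := connect (@adj (map_digraph comp_src) setT).
have reach v : connect (adj setT) (dsrc d0) v ->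
    exists2 e, dsrc (comp_dart e) = v & conn (comp_src e0) (comp_src e).
  have e0P : exists2 e, dsrc (comp_dart e) = dsrc d0 & conn (comp_src e0) (comp_src e).
    by exists e0; rewrite ?e0d // /conn connect0.
  pose P v := [exists e, (dsrc (comp_dart e) == v) && conn (comp_src e0) (comp_src e)].
  move=> d0v; suff: P v by case/existsP => e /andP[/eqP ev ce]; exists e.
  apply: (connect_invariant (P := P)) d0v _; last first.
    by case: e0P => e ed ce; apply/existsP; exists e; rewrite ed eqxx.
  move=> x y /adjP[d _ [dx dy]] /existsP[e /andP[/eqP ex ce]].
  have [f fd] : exists f, comp_dart f = d.
    by apply: comp_dart_onto; rewrite dx -ex comp_dart_src.
  apply/existsP; exists (rev_dart f); apply/andP; split.
    by rewrite -dy -fd; case: (f) => a [].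
  apply: connect_trans ce _; apply: connect1; apply/adjP; exists f; first by rewrite inE.
  rewrite map_dsrc map_dtgt; split=> //.
  by apply: val_inj; rewrite /= fd dx ex.
apply: connected_map_of_digraph => [d e|v|].
- by rewrite comp_rot_orbit rot_s -val_eqE.
- have := valP v; rewrite {2}/K inE => /reach[e ev _].
  by exists e; apply: val_inj.
suff conn0 v : conn (comp_src e0) v.
  move=> u v; apply: connect_trans (conn0 v).
  by rewrite (@adj_connect_sym (map_digraph comp_src)).
have := valP v; rewrite {2}/K inE => /reach[e ev]; suff -> : comp_src e = v by [].
exact: val_inj.
Qed.

Lemma comp_card_arc : #|comp_arc| = #|[set a : arcs D | src a \in K]|.
Proof. by rewrite card_sig; apply: eq_card => a; rewrite !inE. Qed.

Lemma comp_card_vert : #|comp_vert| = #|K|.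
Proof. by rewrite card_sig; apply: eq_card => a; rewrite !inE. Qed.

Lemma comp_card_face :
  #|[set X in porbits t | X \subset [set d | dsrc d \in K]]| <= #|orbit_type comp_t|.
Proof.
rewrite card_orbit_type.
apply: (@leq_trans #|[set comp_dart @: X | X : {set comp_arc * bool} in porbits comp_t]|);
  last exact: leq_imset_card.
apply/subset_leq_card/subsetP => X; rewrite inE => /andP[/imsetP[d _ ->] /subsetP XK].
have [e ed] : exists e, comp_dart e = d.
  by apply: comp_dart_onto; have := XK d; rewrite porbit_id inE; apply.
apply/imsetP; exists (porbit comp_t e); first exact: imset_f.
apply/setP => x; apply/idP/imsetP => [xd|[y]]; last by rewrite comp_face_orbit ed => ? ->.
have [y yx] : exists y, comp_dart y = x.
  by apply: comp_dart_onto; have := XK _ xd; rewrite inE.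
by exists y; rewrite // comp_face_orbit ed yx.
Qed.

Lemma comp_euler_le :
  #|K| + #|[set X in porbits t | X \subset [set d | dsrc d \in K]]| <=
  #|[set a : arcs D | src a \in K]| + 2.
Proof.
by have := euler_le comp_map; have := comp_card_face; rewrite comp_card_arc comp_card_vert; lia.
Qed.

(** The conclusion speaks of directed cycles inside [K], so that colourings of different components
    can be combined. *)
Lemma comp_colouring :
  (forall D : digraph, k_connected D 3 -> cubic D -> planar D ->
     exists M : {set arcs D}, perfect_matching M /\ ~ contains_directed_cut M) ->
  oriented D ->
  #|[set a : arcs D | src a \in K]| + 2 <=
  #|K| + #|[set X in porbits t | X \subset [set d | dsrc d \in K]]| ->
  exists X : {set vert D}, forall c, dicycle c -> {in c, forall a, src a \in K} ->
    ~~ all (fun a => src a \in X) c /\ ~~ all (fun a => src a \notin X) c.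
Proof.
move=> matching orD euler.
have dicycle_val c : @dicycle (map_digraph comp_src) c -> dicycle (map val c).
  by rewrite (@dicycle_map (map_digraph comp_src) D val val) //; exact: val_inj.
have dicycle_val' c : dicycle (map val c) -> @dicycle (map_digraph comp_src) c.
  by rewrite (@dicycle_map (map_digraph comp_src) D val val) //; exact: val_inj.
have [||X [acX acX']] := oriented_map_colouring comp_map _ _ matching.
- by have := comp_card_face; rewrite comp_card_arc comp_card_vert; lia.
- by move=> c /dicycle_val/orD; rewrite size_map.
exists (val @: X) => c dc cK.
have [c' cc'] : exists c' : seq comp_arc, map val c' = c.
  exists (pmap insub c); rewrite pmap_filter; last exact: insubK.
  by apply/all_filterP/allP => a /cK aK; rewrite insubT.
rewrite -cc' in dc cK *; have dc' := dicycle_val' _ dc.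
have srcX a : (src (val a) \in val @: X) = (@src (map_digraph comp_src) a \in X).
  by rewrite -[src (val a)]/(val (@src (map_digraph comp_src) a)) mem_imset //; apply: val_inj.
have := acX _ dc'; have := acX' _ dc'; rewrite !all_map => n1 n2; split.
  by apply: contra n2; apply: sub_all => a /=; rewrite srcX.
by apply: contra n1; apply: sub_all => a /=; rewrite srcX inE.
Qed.

End Component.

(** * Combining the components *)

Lemma matching_planar :
  (forall D : digraph, k_connected D 3 -> cubic D -> planar D ->
     exists M : {set arcs D}, perfect_matching M /\ ~ contains_directed_cut M) ->
  forall D : digraph, oriented D -> planar D ->
    exists X : {set vert D}, acyclic X /\ acyclic (~: X).
Proof.
move=> matching D orD [s rot_s euler].
pose t := (rev_perm (arcs D) * s)%g.
pose comps := [set component setT (dsrc d) | d : dart D].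
pose arcsN (K : {set vert D}) := #|[set a : arcs D | src a \in K]|.
pose facesN (K : {set vert D}) := #|[set X in porbits t | X \subset [set d | dsrc d \in K]]|.
have compE (u v : vert D) : v \in component setT u -> component setT v = component setT u.
  rewrite inE => uv; apply/setP => w; rewrite !inE.
  by rewrite (same_connect (adj_connect_sym setT) uv).
have compV v : v \in component setT v by rewrite inE connect0.
(* Euler's formula holds for the sums over all components, where each term satisfies [le_comp]; a
   strict inequality at [K] would make the total strict. *)
have euler_comp K : K \in comps -> arcsN K + 2 <= #|K| + facesN K.
  move=> Kc; rewrite leqNgt; apply/negP => ltK.
  have le_comp L : L \in comps -> #|L| + facesN L <= arcsN L + 2.
    by case/imsetP => d _ ->; apply: comp_euler_le.
  have lt_sum : \sum_(L in comps) (#|L| + facesN L) < \sum_(L in comps) (arcsN L + 2).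
    rewrite (bigD1 K) //= [X in _ < X](bigD1 K) //= -addSn; apply: leq_add => //.
    by apply: leq_sum => L /andP[/le_comp].
  move: lt_sum; rewrite !big_split /= sum_nat_const ltnNge => /negP; apply.
  have leV : #|[set dsrc d | d : dart D]| <= \sum_(L in comps) #|L|.
    apply: leq_trans (leq_card_cover comps); apply/subset_leq_card/subsetP.
    move=> _ /imsetP[d _ ->]; apply/bigcupP; exists (component setT (dsrc d)) => //.
    exact: imset_f.
  have leF : #|faces s| <= \sum_(L in comps) facesN L.
    rewrite /faces flip_perm -/t.
    apply: (@leq_trans #|\bigcup_(L in comps) [set X in porbits t | X \subset [set d | dsrc d \in L]]|).
      apply/subset_leq_card/subsetP => _ /imsetP[d _ ->]; apply/bigcupP.
      exists (component setT (dsrc d)); first exact: imset_f.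
      rewrite inE imset_f //=; apply/subsetP => e /porbitP[i ->]; rewrite inE.
      elim: i => [|i IHi]; first by rewrite perm1.
      rewrite expgSr permM; set x := (t ^+ i)%g d in IHi *.
      have -> : dsrc (t x) = dtgt x.
        by rewrite permM rev_permE (dsrc_rot rot_s); case: (x) => a [].
      by rewrite component_dart.
    elim/big_ind2: _ => [|Y1 n1 Y2 n2 le1 le2|//]; first by rewrite cards0.
    by apply: leq_trans (leq_card_setU _ _) _; apply: leq_add.
  have leA : \sum_(L in comps) arcsN L <= #|arcs D|.
    rewrite /arcsN; under eq_bigr => L _ do rewrite -sum1dep_card big_mkcond.
    rewrite exchange_big /= -sum1_card; apply: leq_sum => a _.
    rewrite -big_mkcondr sum1dep_card; apply/card_le1_eqP => L L'; rewrite !inE.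
    move=> /andP[/imsetP[d _ ->] /compE <-] /andP[/imsetP[d' _ ->] /compE <-] //.
  by apply: leq_trans (leq_add leV leF); rewrite euler [2 * _]mulnC leq_add2r.
(* The premise [K \in comps] stands under the quantifier so that a choice can be made for all [K] at
   once. *)
have colour_comp K : exists X : {set vert D}, K \in comps ->
    forall c, dicycle c -> {in c, forall a, src a \in K} ->
      ~~ all (fun a => src a \in X) c /\ ~~ all (fun a => src a \notin X) c.
  have [Kc|nK] := boolP (K \in comps); last by exists set0.
  have := euler_comp K Kc; case/imsetP: Kc => d _ -> eulerK.
  by have [X XP] := comp_colouring rot_s matching orD eulerK; exists X.
have [G GP] := fin_all_exists colour_comp.
(* Each vertex takes its colour from the colouring of its own component; a directed cycle stays in
   one component. *)
pose X := [set v | v \in G (component setT v)].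
suff noMono c : dicycle c ->
    ~~ all (fun a => src a \in X) c /\ ~~ all (fun a => src a \notin X) c.
  exists X; split=> c /noMono[nX nX'] //.
  by apply: contra nX'; apply: sub_all => a; rewrite inE.
move=> dc; have [a0 a0c] : exists a, a \in c.
  by case/and3P: dc; case: c => // a c _ _ _; exists a; rewrite mem_head.
pose K := component setT (src a0).
have Kc : K \in comps by apply/imsetP; exists (a0, true).
have [|cK|cK] := @dicycle_constant _ K c dc.
- move=> a _; have := component_dart (a0, true) (a, true); by rewrite /dsrc /dtgt.
- have {}cK : {in c, forall a, src a \in K} by apply/allP.
  have := GP K Kc c dc cK; have XE a : a \in c -> (src a \in X) = (src a \in G K).
    by move=> /cK /compE eqK; rewrite inE eqK.
  case=> n1 n2; split; [apply: contra n1 | apply: contra n2]; move=> /allP cX;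
    by apply/allP => a ac; rewrite -XE // cX.
by have := allP cK a0 a0c; rewrite !inE connect0.
Qed.

Theorem proposition1 :
  ((forall D : digraph, oriented D -> planar D ->
      exists X : {set vert D}, acyclic X /\ acyclic (~: X))
   <->
   (forall D : digraph, k_connected D 3 -> cubic D -> planar D ->
      exists M : {set arcs D}, perfect_matching M /\ ~ contains_directed_cut M))
  /\
  ((forall D : digraph, k_edge_connected D 3 ->
      exists E : {set arcs D}, even_subgraph E /\ strongly_connected (contract E))
   <->
   (forall D : digraph, k_edge_connected D 3 -> cubic D ->
      exists M : {set arcs D}, perfect_matching M /\ ~ contains_directed_cut M)).
Proof.
split; last exact: even_subgraph_iff_matching.
by split; [exact: planar_matching | exact: matching_planar].
Qed.
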